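(* Let $G$ be a non-elementary group admitting a proper, statistically convex-cocompact (SCC) action by isometries on a proper geodesic metric space $(X,d)$ such that $G$ contains a contracting element. Assume that $E(G)=\{1\}$. Let $\mathcal U\subset\mathrm{Sub}(G)$ be a nontrivial uniformly recurrent subgroup. Then there exists $\omega_0<\omega_G$ such that $\omega_{G/H}\le\omega_0$ for every $H\in\mathcal U$.
   Context: $G$ is a discrete group; non-elementary means neither finite nor virtually $\mathbb Z$. Fix a base point $o\in X$. $\mathrm{Sub}(G)$ is the space of all subgroups of $G$ with the topology induced from the product topology on $\{0,1\}^G$ (the Chabauty topology), on which $G$ acts by conjugation. A uniformly recurrent subgroup is a nonempty closed $G$-invariant subset $\mathcal U\subset\mathrm{Sub}(G)$ that is minimal (every $G$-orbit in $\mathcal U$ is dense in $\mathcal U$). It is nontrivial if $\mathcal U\neq\{\{1\}\}$. Contracting elements: for closed $Z\subseteq X$ let $\pi_Z(x)=\{y\in Z: d(x,y)=d(x,Z)\}$. $Z$ is $C$-contracting ($C>0$) if for all $x,y\in X$, $d(x,y)\le d(x,Z)$ implies $\mathrm{diam}(\pi_Z(x)\cup\pi_Z(y))\le C$. An element $h\in G$ is contracting if $n\in\mathbb Z\mapsto h^n o$ is a quasi-geodesic whose image is $C$-contracting for some $C$. $E(G)$ denotes the maximal finite normal subgroup of $G$ (it exists in this setting). Growth rates: $B(n)=\{g\in G: d(o,go)\le n\}$; for $Z\subseteq G$, $\omega_Z=\limsup_{n\to\infty} n^{-1}\ln|B(n)\cap Z|$. For a subgroup $H$, $B_{G/H}(n)=\{gH: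 d(o,gHo)\le n\}$ and $\omega_{G/H}=\limsup_{n\to\infty} n^{-1}\ln|B_{G/H}(n)|$. It is assumed that $\omega_G<\infty$. SCC: for $0\le M_1\le M_2$, let $\mathcal O_{M_1,M_2}$ be the set of $g\in G$ for which there is a geodesic joining a point of $N_{M_2}(o)$ to a point of $N_{M_2}(go)$ whose interior lies outside $N_{M_1}(Go)$, where $N_r(A)=\{y\in X: d(y,A)\le r\}$. The proper action is SCC if there are $M_1,M_2>0$ with $\omega_{\mathcal O_{M_1,M_2}}<\omega_G<\infty$. *)

(* Defs.v *)
From HB Require Import structures.
From mathcomp Require Import all_boot all_order all_algebra.
From mathcomp Require Import all_classical all_reals all_analysis.

Set Implicit Arguments.
Unset Strict Implicit.
Unset Printing Implicit Defensive.

Import Order.TTheory GRing.Theory Num.Theory.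
Import numFieldNormedType.Exports.

Local Open Scope classical_set_scope.
Local Open Scope ring_scope.

(* The extended pseudometric distance [edist], on which the library's
   point-to-set distance [edist_inf] is built, is the metric [mdist]. *)
Lemma edist_mdist (R : realType) (X : metricType R) (x y : X) :
  edist (x, y) = (mdist x y)%:E.
Proof.
apply/eqP; rewrite eq_le; apply/andP; split.
  apply/lee_addgt0Pr => e e0; rewrite -EFinD; apply: edist_fin.
    by rewrite ltr_wpDl // mdist_ge0.
  by rewrite ballEmdist /= ltrDl.
apply: le_ereal_inf_tmp => _ [r [r0 +] <-].
by rewrite /= ballEmdist /= lee_fin => /ltW.
Qed.

Section Subgroups.
Variable G : groupType.

Definition is_subgroup : set {ptws G -> bool} :=
  [set H | group_closed (fun x : G => H x)].

(* Sub(G), a subspace of {0,1}^G with the product topology. *)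
Definition subgroup_space : Type := set_type is_subgroup.

HB.instance Definition _ :=
  Topological.copy subgroup_space (set_type is_subgroup).

Definition carrier (H : subgroup_space) : set G := [set x | set_val H x].

Definition mkSub (H : {ptws G -> bool})
    (closedH : group_closed (fun x : G => H x)) : subgroup_space :=
  exist _ H (mem_set (closedH : is_subgroup H)).

Fact triv_closed : group_closed (fun x : G => x == 1%g).
Proof.
split; first by rewrite unfold_in.
by move=> x y; rewrite !unfold_in => /eqP -> /eqP ->; rewrite divg1.
Qed.

Definition triv_subgroup : subgroup_space := mkSub triv_closed.

Fact conjSub_closed (g : G) (H : subgroup_space) :
  group_closed (fun x : G => set_val H (x ^ g)%g).
Proof.
have [H1 HB] : group_closed (fun x : G => set_val H x) := set_valP H.
split; first by rewrite unfold_in conj1g.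
by move=> x y Hx Hy; rewrite unfold_in conjMg conjVg; exact: HB.
Qed.

(* As [x ^ g] is [g^-1 * x * g], this is the subgroup [g H g^-1]. *)
Definition conjSub (g : G) (H : subgroup_space) : subgroup_space :=
  mkSub (conjSub_closed g H).

Definition conj_orbit (H : subgroup_space) : set subgroup_space :=
  range (conjSub^~ H).

Definition uniformly_recurrent (U : set subgroup_space) :=
  [/\ U !=set0, closed U, (forall g H, U H -> U (conjSub g H)) &
      forall H, U H -> U `<=` closure (conj_orbit H)].

Definition normalSub (H : subgroup_space) := forall g, conjSub g H = H.

(* E(G) is the maximum, not just a maximal element, among the finite normal
   subgroups. *)
Definition maximal_finite_normal (E : subgroup_space) :=
  [/\ finite_set (carrier E), normalSub E &
      forall F : subgroup_space, finite_set (carrier F) -> normalSub F ->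
        carrier F `<=` carrier E].

Definition left_coset (g : G) (H : subgroup_space) : set G :=
  [set (g * h)%g | h in carrier H].

Definition finite_index (H : subgroup_space) :=
  finite_set (range (left_coset^~ H)).

Definition virtually_Z :=
  exists2 K : subgroup_space, finite_index K &
  exists f : int -> G, [/\ forall m n, f (m + n) = (f m * f n)%g,
    injective f & range f = carrier K].

Definition non_elementary := ~ finite_set [set: G] /\ ~ virtually_Z.

Definition expgz (h : G) (n : int) : G :=
  match n with Posz k => (h ^+ k)%g | Negz k => (h ^- k.+1)%g end.

End Subgroups.

Section MetricNotions.
Variables (R : realType) (X : metricType R).

Definition proper_space :=
  forall (x : X) (r : R), compact [set y | mdist x y <= r].

Definition geodesic (L : R) (gamma : R -> X) :=
  0 <= L /\ {in `[0, L] &, forall s t, mdist (gamma s) (gamma t) = `|s - t|}.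

Definition geodesic_space := forall x y : X,
  exists L gamma, [/\ geodesic L gamma, gamma 0 = x & gamma L = y].

Definition neighborhood (r : R) (A : set X) : set X :=
  [set y | (edist_inf A y <= r%:E)%E].

Definition nearest_proj (Z : set X) (x : X) : set X :=
  [set y | Z y /\ (mdist x y)%:E = edist_inf Z x].

Definition diam (A : set X) : \bar R :=
  ereal_sup [set (mdist p.1 p.2)%:E | p in A `*` A].

Definition contracting_set (C : R) (Z : set X) :=
  [/\ 0 < C, closed Z &
      forall x y, ((mdist x y)%:E <= edist_inf Z x)%E ->
        (diam (nearest_proj Z x `|` nearest_proj Z y) <= C%:E)%E].

Definition quasi_geodesic (u : int -> X) :=
  exists lambda c : R, [/\ 1 <= lambda, 0 <= c &
    forall m n : int,
      lambda^-1 * `|m - n|%:~R - c <= mdist (u m) (u n)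
                                   <= lambda * `|m - n|%:~R + c].

End MetricNotions.

Section Actions.
Variables (R : realType) (G : groupType) (X : metricType R).
Variables (act : G -> X -> X).

Definition isometric_action :=
  [/\ forall x, act 1%g x = x,
      forall g h x, act (g * h)%g x = act g (act h x) &
      forall g x y, mdist (act g x) (act g y) = mdist x y].

Definition proper_action := forall K : set X, compact K ->
  finite_set [set g | (act g @` K) `&` K !=set0].

Variable o : X.

Definition contracting_element (h : G) :=
  quasi_geodesic (fun n : int => act (expgz h n) o) /\
  exists C, contracting_set C (range (fun n : int => act (expgz h n) o)).

(* [counting] and [lne] take values in the extended reals:
   [lne 0 = -oo] and [lne +oo = +oo]. *)
Definition exp_growth (T : choiceType) (B : nat -> set T) : \bar R :=
  limn_esup (fun n => (n%:R^-1)%:E * lne (counting (B n)))%E.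

Definition gball (n : nat) : set G := [set g | mdist o (act g o) <= n%:R].

Definition growth (Z : set G) : \bar R :=
  exp_growth (fun n => gball n `&` Z).

Definition coset_ball (H : subgroup_space G) (n : nat) : set (set G) :=
  [set left_coset g H | g in
    [set g | (edist_inf (act^~ o @` left_coset g H) o <= n%:R%:E)%E]].

Definition coset_growth (H : subgroup_space G) : \bar R :=
  exp_growth (coset_ball H).

Definition barrier_free (M1 M2 : R) : set G :=
  [set g | exists L gamma, [/\ geodesic L gamma,
     neighborhood M2 [set o] (gamma 0),
     neighborhood M2 [set act g o] (gamma L) &
     forall t, 0 < t < L -> ~ neighborhood M1 (range (act^~ o)) (gamma t)]].

Definition SCC :=
  exists M1 M2 : R, [/\ 0 < M1, M1 <= M2,
    (growth (barrier_free M1 M2) < growth setT)%E &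
    (growth setT < +oo)%E].

End Actions.

(* Main.v *)
(** By compactness, there is a finite set [P] of nontrivial elements such that
    every [H] in [U] and every [g] satisfy [g p g^-1] in [H] for some [p] in [P].
    Represent each coset of [H] by an element [v] of minimal length in [H v] and
    cut a geodesic from [o] to [v o] at the places where it passes close to the
    orbit.  If there are few such places, then [v] is a product of few elements of
    bounded length and few barrier-free elements; since the Poincare series of the
    barrier-free elements converges at some exponent below the growth rate of [G],
    such [v] are exponentially rare.  Otherwise there are linearly many places, and
    at any subset of them one inserts elements of [H], conjugate to
    [f = k^-1 h^N e h^-N k] where [h] is contracting and [e] is conjugate to an
    element of [P] and does not commensurate [<h>].  The contraction property makes
    the resulting words almost geodesic.  The minimality of [v] bounds the number of
    insertions leading to the same word.  Hence the number of minimal [v] of length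
    at most [n] is smaller than the ball of radius [n] by an exponential factor
    depending only on [P]. *)
Require Import Defs.
From HB Require Import structures.
From mathcomp Require Import all_boot all_order all_algebra.
From mathcomp Require Import all_classical all_reals all_analysis.
From mathcomp Require Import ring lra zify.

Set Implicit Arguments.
Unset Strict Implicit.
Unset Printing Implicit Defensive.

Import Order.TTheory GRing.Theory Num.Theory.
Import numFieldNormedType.Exports.

Local Open Scope classical_set_scope.
Local Open Scope ring_scope.

(** * Contracting sets *)

(** Balls of [G] are only known to be bounded at exponents [t] above the growth rate [w], with no
    matching lower bound at [w]. The saving therefore has to be exponential in its own right:
    inserting at all subsets of [m] positions gains a factor [(1 + kap) ^ m] with [m] proportional
    to [n], and [kap] is fixed before [t], so that [t] can be moved close enough to [w] for the gain
    to win.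

    The triviality of E(G) serves to find [e]: the elements all of whose conjugates commensurate
    [<h>] form a finite normal subgroup, so a nontrivial element always has a conjugate outside the
    commensurator, and one conjugator can be made to work for a whole finite set. The corrector [k],
    taken among three candidates, turns both neighbouring pieces away from the axis at the insertion
    point.

    Cut points are only [M1]-close to the geodesic, so the pieces inherit minimality up to an
    additive [4 * M1]. The exponent [N] is chosen after this error, so that undoing an insertion
    saves more than the error. *)

Section ContractingGeometry.
Variables (R : realType) (X : metricType R).
Implicit Types (Z Y : set X) (x y z w p q : X) (C : R).

Definition is_proj Z x p := Z p /\ forall z, Z z -> mdist x p <= mdist x z.

(** Working form of [contracting_set] with real distances: [edist_inf] and [diam] give way to bounds
    on individual nearest points, whose existence becomes part of the notion. *)
Definition contr C Z := [/\ 0 < C, forall x, exists p, is_proj Z x p &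
  forall x y p q, is_proj Z x p -> is_proj Z y q -> mdist x y <= mdist x p ->
    mdist p q <= C].

Lemma edist_inf_proj Z x p : is_proj Z x p -> edist_inf Z x = (mdist x p)%:E.
Proof.
move=> [Zp pmin]; apply/eqP; rewrite eq_le; apply/andP; split.
  by apply: ereal_inf_lbound; exists p => //; rewrite edist_mdist.
by apply: le_ereal_inf_tmp => _ [z Zz <-]; rewrite edist_mdist lee_fin pmin.
Qed.

Lemma proj_nearest Z x p : is_proj Z x p <-> nearest_proj Z x p.
Proof.
split=> [px|[Zp dp]]; first by split; [case: px | rewrite (edist_inf_proj px)].
split=> // z Zz; rewrite -lee_fin dp.
by apply: ereal_inf_lbound; exists z => //; rewrite edist_mdist.
Qed.

Lemma contracting_set_contr C Z : (forall x, exists p, is_proj Z x p) ->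
  contracting_set C Z -> contr C Z.
Proof.
move=> ex [C0 _ cZ]; split=> // x y p q px qy dxy.
have /(cZ x y) dC : ((mdist x y)%:E <= edist_inf Z x)%E.
  by rewrite (edist_inf_proj px) lee_fin.
rewrite -lee_fin; apply: le_trans dC.
apply: ereal_sup_ubound; exists (p, q) => //=.
by split; [left|right]; apply/proj_nearest.
Qed.

Hypothesis geodX : geodesic_space X.

Lemma geod_point x y t : 0 <= t <= mdist x y ->
  exists w, mdist x w = t /\ mdist w y = mdist x y - t.
Proof.
move=> /andP[t0 txy]; have [L [g [[L0 isog] g0 gL]]] := geodX x y.
have xyL : mdist x y = L.
  by rewrite -g0 -gL isog ?in_itv/= ?lexx ?L0// sub0r normrN ger0_norm.
exists (g t); split.
  by rewrite -g0 isog ?in_itv/= ?lexx ?L0 ?t0 -?xyL// sub0r normrN ger0_norm.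
rewrite xyL -gL isog ?in_itv/= ?lexx ?L0 ?t0 -?xyL//.
by rewrite distrC ger0_norm ?subr_ge0.
Qed.

Lemma mdist_tri y x z : mdist x z <= mdist x y + mdist y z.
Proof. exact: metric_triangle. Qed.

(** March from [x] towards [z] in steps equal to the current distance to [Z]. Each step moves the
    projection by at most [C], which the next step repays as long as its length is at least [C];
    closer to [Z] the triangle inequality suffices. *)
Lemma contr_gromov C Z x p z : contr C Z -> is_proj Z x p -> Z z ->
  mdist x p + mdist p z - 2 * C <= mdist x z.
Proof.
move=> [C0 ex cZ] + Zz.
have [n] : exists n : nat, mdist x z <= n%:R * C.
  exists (Num.bound (mdist x z / C)).
  rewrite -ler_pdivrMr//; apply/ltW/archi_boundP.
  by rewrite divr_ge0 ?mdist_ge0// ltW.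
elim: n x p => [|n IH] x p nC px; have [Zp pmin] := px; have dxz := pmin _ Zz.
  have := mdist_tri x p z; rewrite (metric_sym p x); have := mdist_ge0 x z; lra.
have [pC|Cp] := ltP (mdist x p) C.
  have := mdist_tri x p z; rewrite (metric_sym p x); lra.
have /geod_point[w [xw wz]] : 0 <= mdist x p <= mdist x z.
  by rewrite mdist_ge0/= dxz.
have [q qw] := ex w.
have pq : mdist p q <= C by apply: (cZ x w) => //; rewrite xw.
have tri := mdist_tri q p z.
have [wC|Cw] := ltP (mdist w q) C.
  have := mdist_tri w q z; rewrite (metric_sym q w); lra.
have /IH /(_ qw) : mdist w z <= n%:R * C.
  by rewrite wz; move: nC; rewrite -natr1 mulrDl mul1r; lra.
lra.
Qed.

(** While the geodesic stays [2 * C] away from [Z], every step of the same march has length at least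
    [2 * C] and moves the projection by at most [C]: the projection travels at half speed. *)
Lemma contr_far_or_near C Z x y p q : contr C Z -> is_proj Z x p -> is_proj Z y q ->
  (exists w r, [/\ mdist x w + mdist w y = mdist x y, is_proj Z w r &
     mdist w r < 2 * C]) \/
  mdist p q <= 2 * C + Num.max 0 (mdist x y - mdist x p) / 2.
Proof.
move=> [C0 ex cZ] + qy.
have [n] : exists n : nat, mdist x y <= n%:R * C.
  exists (Num.bound (mdist x y / C)).
  rewrite -ler_pdivrMr//; apply/ltW/archi_boundP.
  by rewrite divr_ge0 ?mdist_ge0// ltW.
elim: n x p => [|n IH] x p nC px.
  right; have : mdist p q <= C.
    apply: (cZ x y) => //; have := mdist_ge0 x p; lra.
  by rewrite maxElt; case: ifP; lra.
have [pC|Cp] := ltP (mdist x p) (2 * C).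
  by left; exists x, p; rewrite mdistxx add0r.
have [xyp|pxy] := leP (mdist x y) (mdist x p).
  right; have : mdist p q <= C by apply: (cZ x y).
  by rewrite maxElt; case: ifP; lra.
have /geod_point[w [xw wy]] : 0 <= mdist x p <= mdist x y.
  by rewrite mdist_ge0/= ltW.
have [r rw] := ex w.
have pr : mdist p r <= C by apply: (cZ x w) => //; rewrite xw.
have tri := mdist_tri r p q.
have [rC|Cr] := ltP (mdist w r) (2 * C).
  by left; exists w, r; split => //; lra.
have /IH /(_ rw) [] : mdist w y <= n%:R * C.
- by rewrite wy; move: nC; rewrite -natr1 mulrDl mul1r; lra.
- move=> [w' [r' [ww' w'r' r'C]]]; left; exists w', r'; split => //.
  have := mdist_tri w x w'; have := mdist_tri w' x y; lra.
- move=> wq; right.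
  have [wr|rw'] := leP (mdist w y) (mdist w r).
    have : mdist r q <= C by apply: (cZ w y).
    by rewrite maxElt; case: ifP; lra.
  by move: wq; rewrite !maxElt; do 2 case: ifP; lra.
Qed.

(** Far projections force the geodesic to pass within [2 * C] of [Z]. Applying [contr_gromov] from
    both ends to the projection of that point loses [4 * C], the detour to [Z] another [4 * C]. *)
Lemma proj_sym_far C Z x y p q : contr C Z -> is_proj Z x p -> is_proj Z y q ->
  6 * C < mdist p q ->
  mdist x p + mdist p q + mdist q y - 8 * C <= mdist x y.
Proof.
move=> cC px qy pq6.
have [Zp pmin] := px; have [Zq qmin] := qy.
have [w [r [xwy rw rC]]] : exists w r,
    [/\ mdist x w + mdist w y = mdist x y, is_proj Z w r & mdist w r < 2 * C].
  have upper : mdist x y <= mdist x p + mdist p q + mdist q y.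
    by have := mdist_tri p x y; have := mdist_tri q p y; lra.
  have [C0 ex cZ] := cC.
  have [small|big] := leP (mdist x y) (mdist x p + mdist y q).
    (* The balls around [x] and [y] that reach [Z] share a point [w] of the geodesic, whose
       projection is within [C] of both [p] and [q]. *)
    exfalso.
    have /geod_point[w [xw wy]] : 0 <= Num.min (mdist x p) (mdist x y) <= mdist x y.
      by rewrite le_min !mdist_ge0/= ge_min lexx orbT.
    have [r rw] := ex w.
    have pr : mdist p r <= C.
      by apply: (cZ x w) => //; rewrite xw ge_min lexx.
    have qr : mdist q r <= C.
      apply: (cZ y w) => //; rewrite metric_sym wy minElt.
      have := mdist_ge0 y q; case: ifP; lra.
    have := mdist_tri r p q; rewrite (metric_sym r q); lra.
  have /geod_point[w [xw wy]] : 0 <= mdist x y - mdist y q <= mdist x y.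
    by have := mdist_ge0 y q; have := mdist_ge0 x p; lra.
  have [r rw] := ex w.
  have qr : mdist q r <= C by apply: (cZ y w) => //; rewrite metric_sym; lra.
  (* Outside the two balls the geodesic has length at most [mdist p q], so the second alternative
     would give [mdist p q <= 3 * C + mdist p q / 2]. This is the origin of [6 * C]. *)
  have [[w' [r' [xw'w r'w' r'C]]]|] := contr_far_or_near cC px rw.
    exists w', r'; split => //.
    have := mdist_tri w w' y; have := mdist_tri w' x y; lra.
  have := mdist_tri r p q; rewrite (metric_sym r q) (metric_sym q y) maxElt in upper *.
  case: ifP; lra.
have Zr := rw.1.
have := contr_gromov cC px Zr; have := contr_gromov cC qy Zr.
have := mdist_tri w x r; have := mdist_tri w y r; have := mdist_tri r p q.
rewrite (metric_sym r q) (metric_sym y q) (metric_sym y w); lra.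
Qed.

Lemma proj_lip C Z x y p q : contr C Z -> is_proj Z x p -> is_proj Z y q ->
  mdist p q <= mdist x y + 8 * C.
Proof.
move=> cC px qy; have [C0 _ _] := cC.
have := mdist_ge0 x p; have := mdist_ge0 q y; have := mdist_ge0 x y.
have [|/(proj_sym_far cC px qy)] := leP (mdist p q) (6 * C); lra.
Qed.

(** The projection of [w] is within [C] of [p], hence still more than [6 * C] from [q]. By
    [proj_sym_far], a point [w] further than [9 * C] from [Z] would make the geodesic longer than
    the detour through [p] and [q]. *)
Lemma proj_on_geodesic C Z x y w p q : contr C Z -> is_proj Z x p -> is_proj Z y q ->
  7 * C < mdist p q -> mdist x w = mdist x p ->
  mdist x w + mdist w y = mdist x y -> mdist w p <= 10 * C.
Proof.
move=> cC px qy pq6 xw xwy; have [C0 ex cZ] := cC.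
have [r rw] := ex w.
have pr : mdist p r <= C by apply: (cZ x w) => //; rewrite xw.
have := mdist_tri p x y; have := mdist_tri q p y; have := mdist_tri r p q.
have := mdist_tri r w p; rewrite (metric_sym r p).
have [rq|/(proj_sym_far cC rw qy)] := leP (mdist r q) (6 * C); lra.
Qed.

(* A Behrstock-type inequality. If both alternatives failed, [proj_sym_far]
   would put [q] between [x] and [p] and also [p] between [x] and [q]. *)
Lemma behrstock C Z Y x p q p' q' : contr C Z -> contr C Y ->
  is_proj Z x p -> is_proj Y x q -> is_proj Z q p' -> is_proj Y p q' ->
  mdist p p' <= 16 * C \/ mdist q q' <= 6 * C.
Proof.
move=> cZ cY px qx p'q q'p; have [C0 _ _] := cZ.
have [|pp'] := leP (mdist p p') (16 * C); [by left | right].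
rewrite leNgt; apply/negP => /(proj_sym_far cY qx q'p).
have := @proj_sym_far _ _ _ _ _ _ cZ px p'q.
have := mdist_ge0 p' q; have := mdist_ge0 q q'; have := mdist_ge0 q' p; lra.
Qed.
End ContractingGeometry.

Lemma pigeonhole (T : eqType) (s : seq T) (f : nat -> T) :
  (forall k, (k <= size s)%N -> f k \in s) ->
  exists i j, [/\ (i < j)%N, (j <= size s)%N & f i = f j].
Proof.
move=> fs; apply: contrapT => noteq.
have : uniq (mkseq f (size s).+1).
  rewrite map_inj_in_uniq ?iota_uniq// => i j.
  rewrite !mem_iota !add0n /= !ltnS => ki kj fij; apply: contrapT => /eqP.
  rewrite neq_ltn => /orP[ij|ji]; apply: noteq.
    by exists i, j.
  by exists j, i.
move=> /uniq_leq_size le_size; have /le_size : {subset mkseq f (size s).+1 <= s}.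
  by move=> x /mapP[k]; rewrite mem_iota add0n ltnS => /= ks ->; exact: fs.
by rewrite size_mkseq ltnn.
Qed.

(** * Contracting elements *)

Section IntegerPowers.
Variable G : groupType.
Implicit Types (g h x : G) (m n : int).

Lemma expgzD1 h n : expgz h (n + 1) = (expgz h n * h)%g.
Proof.
case: n => [k|[|k]] /=.
- by rewrite addn1 expgSr.
- by rewrite subnn expg0 mulVg.
- by rewrite subn1 /= (expgS _ k.+1) invgM mulgVK.
Qed.

Lemma expgzD h m n : expgz h (m + n) = (expgz h m * expgz h n)%g.
Proof.
elim/int_rec: n => [|n IH|n IH]; first by rewrite addr0 mulg1.
- have -> : (n.+1 : int) = n%:Z + 1 by lia.
  by rewrite addrA !expgzD1 IH mulgA.
- apply: (@mulIg _ h); rewrite -mulgA -!expgzD1.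
  have -> : m + - (n.+1)%:Z + 1 = m + - n%:Z by lia.
  by have -> : - (n.+1)%:Z + 1 = - n%:Z by lia.
Qed.

Lemma expgzN h n : expgz h (- n) = (expgz h n)^-1%g.
Proof. by apply/esym/mulg1_eq; rewrite -expgzD subrr. Qed.

Lemma expgz_conj g h n : expgz (g * h * g^-1)%g n = (g * expgz h n * g^-1)%g.
Proof.
elim/int_rec: n => [|n IH|n IH]; first by rewrite /= mulg1 mulgV.
- have -> : (n.+1 : int) = n%:Z + 1 by lia.
  by rewrite !expgzD1 IH !mulgA mulgVK.
- apply: (@mulIg _ (g * h * g^-1)%g); rewrite -expgzD1.
  have -> : - (n.+1)%:Z + 1 = - n%:Z by lia.
  rewrite IH !mulgA mulgVK -(mulgA g _ h) -expgzD1.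
  by have -> : - (n.+1)%:Z + 1 = - n%:Z by lia.
Qed.

Lemma expgzM h m n : expgz (expgz h m) n = expgz h (m * n).
Proof.
elim/int_rec: n => [|n IH|n IH]; first by rewrite /= mulr0.
- have -> : (n.+1 : int) = n%:Z + 1 by lia.
  by rewrite expgzD1 IH mulrDr mulr1 expgzD.
- apply: (@mulIg _ (expgz h m)); rewrite -expgzD1 -expgzD.
  have -> : - (n.+1)%:Z + 1 = - n%:Z by lia.
  by rewrite IH; congr expgz; lia.
Qed.

Lemma expgzC h m n : (expgz h m * expgz h n)%g = (expgz h n * expgz h m)%g.
Proof. by rewrite -!expgzD addrC. Qed.

(* The commensurator of the cyclic subgroup generated by [h]; when [h] is
   contracting this is the maximal elementary subgroup containing [h]. *)
Definition elementary h : set G :=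
  [set x | exists i j : int,
    [/\ i != 0, j != 0 & (x * expgz h i = expgz h j * x)%g]].

Lemma elementary_pow h x i j n : (x * expgz h i = expgz h j * x)%g ->
  (x * expgz h (i * n) = expgz h (j * n) * x)%g.
Proof.
move=> e; have /(congr1 (fun y => expgz y n)) : (x * expgz h i * x^-1)%g = expgz h j.
  by rewrite e mulgK.
by rewrite /= expgz_conj !expgzM => <-; rewrite mulgVK.
Qed.

Lemma elementary_expgz h n : elementary h (expgz h n).
Proof. by exists 1, 1; split => //; rewrite expgzC. Qed.

Lemma elementary1 h : elementary h 1%g.
Proof. exact: (elementary_expgz h 0). Qed.

Lemma elementaryV h x : elementary h x -> elementary h x^-1%g.
Proof.
move=> [i [j [i0 j0 e]]]; exists j, i; split => //.
by apply: (@mulgI _ x); rewrite !mulgA mulgV mul1g e mulgK.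
Qed.

Lemma elementaryM h x y : elementary h x -> elementary h y ->
  elementary h (x * y)%g.
Proof.
move=> [i [j [i0 j0 ex]]] [k [l [k0 l0 ey]]].
exists (k * i), (j * l); split; rewrite ?mulf_neq0//.
by rewrite -mulgA (elementary_pow i ey) !mulgA [l * i]mulrC (elementary_pow l ex).
Qed.

Lemma elementaryMr h x y : elementary h y ->
  elementary h (x * y)%g <-> elementary h x.
Proof.
move=> Ey; split; last by move=> Ex; exact: elementaryM.
by move=> /elementaryM /(_ (elementaryV Ey)); rewrite mulgK.
Qed.
End IntegerPowers.

(** * Orbit lengths and translates of contracting sets *)

Section IsometricAction.
Variables (R : realType) (G : groupType) (X : metricType R).
Variables (act : G -> X -> X) (o : X).
Hypothesis isoA : isometric_action act.

Definition len (g : G) : R := mdist o (act g o).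

Lemma act1 x : act 1%g x = x. Proof. by case: isoA. Qed.

Lemma actM g k x : act (g * k)%g x = act g (act k x).
Proof. by case: isoA. Qed.

Lemma mdist_act g x y : mdist (act g x) (act g y) = mdist x y.
Proof. by case: isoA. Qed.

Lemma actK g x : act g^-1%g (act g x) = x.
Proof. by rewrite -actM mulVg act1. Qed.

Lemma actVK g x : act g (act g^-1%g x) = x.
Proof. by rewrite -actM mulgV act1. Qed.

Lemma mdist_actl g x y : mdist (act g x) y = mdist x (act g^-1%g y).
Proof. by rewrite -(mdist_act g^-1%g) actK. Qed.

Lemma mdist_orbit g k : mdist (act g o) (act k o) = len (g^-1 * k)%g.
Proof. by rewrite mdist_actl /len actM. Qed.

Lemma len_ge0 g : 0 <= len g. Proof. exact: mdist_ge0. Qed.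

Lemma len1 : len 1%g = 0. Proof. by rewrite /len act1 mdistxx. Qed.

Lemma lenV g : len g^-1%g = len g.
Proof. by rewrite /len -mdist_actl metric_sym. Qed.

Lemma lenM g k : len (g * k)%g <= len g + len k.
Proof. by rewrite {1}/len actM (le_trans (mdist_tri (act g o) _ _))// mdist_act. Qed.

Lemma proj_translate Z g x p :
  is_proj (act g @` Z) (act g x) (act g p) <-> is_proj Z x p.
Proof.
split=> [[[p' Zp' pp'] pmin]|[Zp pmin]]; split.
- by rewrite -(actK g p) -pp' actK.
- by move=> z Zz; rewrite -(mdist_act g) -(mdist_act g x) pmin//; exists z.
- by exists p.
- by move=> _ [z Zz <-]; rewrite !mdist_act pmin.
Qed.

Lemma contr_translate C Z g : contr C Z -> contr C (act g @` Z).
Proof.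
move=> [C0 ex cZ]; split=> // [x|x y p q].
  have [p px] := ex (act g^-1%g x); exists (act g p).
  by rewrite -(actVK g x); apply/proj_translate.
rewrite -{1}(actVK g x) -{1}(actVK g p) -{1}(actVK g y) -{1}(actVK g q).
move=> /proj_translate px /proj_translate qy dxy.
by rewrite -(mdist_act g^-1%g) (cZ _ _ _ _ px qy)// !mdist_act.
Qed.
End IsometricAction.

(** * The axis of a contracting element and its commensurator *)

Section ContractingElement.
Variables (R : realType) (G : groupType) (X : metricType R).
Variables (act : G -> X -> X) (o : X).
Hypothesis geodX : geodesic_space X.
Hypothesis isoA : isometric_action act.
Hypothesis ball_finite : forall r, finite_set [set g | len act o g <= r].
Variables (h : G) (lam c C : R).
Hypotheses (lam1 : 1 <= lam) (c0 : 0 <= c).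

Local Notation a := (expgz h).
Local Notation axis := (range (fun n : int => act (expgz h n) o)).
Local Notation E := (elementary h).
Local Notation ell := (len act o).

Hypothesis qgeo : forall m n : int,
  lam^-1 * `|m - n|%:~R - c <= mdist (act (a m) o) (act (a n) o)
    <= lam * `|m - n|%:~R + c.
Hypothesis cZ : contr C axis.

Lemma C_gt0 : 0 < C. Proof. by case: cZ. Qed.

Lemma axis_pow n : axis (act (a n) o). Proof. by exists n. Qed.

Lemma axis_o : axis o. Proof. by exists 0 => //; rewrite /= act1. Qed.

Lemma axis_proj x : exists p, is_proj axis x p. Proof. by case: cZ. Qed.

Lemma image_axis_pow n : act (a n) @` axis = axis.
Proof.
apply/seteqP; split=> [_ [_ [m _ <-] <-]|_ [m _ <-]].
  by exists (n + m) => //; rewrite -actM// -expgzD.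
exists (act (a (m - n)) o); first exact: axis_pow.
by rewrite -actM// -expgzD addrC subrK.
Qed.

Lemma proj_pow n x p : is_proj axis x p -> is_proj axis (act (a n) x) (act (a n) p).
Proof. by move=> /(proj_translate isoA _ (a n)); rewrite image_axis_pow. Qed.

Lemma proj_axis_lip x y p q : is_proj axis x p -> is_proj axis y q ->
  mdist p q <= mdist x y + 8 * C.
Proof. exact: proj_lip. Qed.

Lemma len_pow n : lam^-1 * `|n|%:~R - c <= ell (a n).
Proof.
by have /andP[+ _] := qgeo 0 n; rewrite sub0r normrN /= act1.
Qed.

Lemma len_pow_le n : ell (a n) <= lam * `|n|%:~R + c.
Proof.
by have /andP[_ +] := qgeo 0 n; rewrite sub0r normrN /= act1.
Qed.

(* Otherwise the axis and its translate by [g] fellow-travel for a long time, and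
   the pigeonhole principle gives [g h^i = h^j g] with [i] and [j] nonzero. *)
Lemma bounded_projection : exists B, forall g, ~ E g -> forall x y p q,
  axis x -> axis y -> is_proj axis (act g x) p -> is_proj axis (act g y) q ->
  mdist p q <= B.
Proof.
have C0 := C_gt0.
(* The geodesic is [2 * C]-close to the translated axis and, on its middle part, [22 * C]-close to
   the axis, so comparing nearby orbit points gives elements of length at most [24 * C]. The spacing
   [sg] exceeds [2 * 22 * C], so distinct times use distinct powers of [h]. *)
have /finite_seqP[s sE] := ball_finite (24 * C).
pose sg := 44 * C + 1; exists (28 * C + (size s)%:R * sg).
move=> g nE x y p q Zx Zy px qy; apply: contra_notP nE => /negP; rewrite -ltNge => big.
have [L [gam [[L0 isog] g0 gL]]] := geodX (act g x) (act g y).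
have sg0 : 0 < sg by rewrite /sg; lra.
have ssg0 : 0 <= (size s)%:R * sg by rewrite mulr_ge0// ltW.
have L_E : mdist (act g x) (act g y) = L.
  by rewrite -g0 -gL isog ?in_itv/= ?lexx ?L0// sub0r normrN ger0_norm.
have from0 t : 0 <= t <= L -> mdist (act g x) (gam t) = t.
  move=> /andP[t0 tL].
  by rewrite -g0 isog ?in_itv/= ?lexx ?L0 ?t0// sub0r normrN ger0_norm.
have toL t : 0 <= t <= L -> mdist (gam t) (act g y) = L - t.
  move=> /andP[t0 tL]; rewrite -gL isog ?in_itv/= ?lexx ?L0 ?t0//.
  by rewrite distrC ger0_norm// subr_ge0.
have far := @proj_sym_far _ _ geodX _ _ _ _ _ _ cZ px qy.
have p0 := mdist_ge0 (act g x) p; have q0 := mdist_ge0 q (act g y).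
have {}far : mdist (act g x) p + mdist p q + mdist q (act g y) - 8 * C <= L.
  by rewrite -L_E; apply: far; lra.
set t1 := mdist (act g x) p in far p0 *.
set d2 := mdist q (act g y) in far q0 *; pose t2 := L - d2.
have t1L : 0 <= t1 <= L by lra.
have t2L : 0 <= t2 <= L by rewrite /t2; lra.
have near1 : mdist (gam t1) p <= 10 * C.
  by apply: (proj_on_geodesic geodX cZ px qy);
    [lra | rewrite from0 | rewrite from0// toL// L_E; lra].
have near2 : mdist (gam t2) q <= 10 * C.
  apply: (proj_on_geodesic geodX cZ qy px); rewrite metric_sym; first lra.
    by rewrite toL// metric_sym -/d2 /t2; lra.
  by rewrite toL// metric_sym from0// metric_sym L_E; lra.
have dd t t' : 0 <= t -> t <= t' -> t' <= L -> mdist (gam t) (gam t') = t' - t.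
  move=> t0 tt' t'L; rewrite isog ?in_itv/= ?t0 ?t'L ?(le_trans t0)//=.
    by rewrite distrC ger0_norm// subr_ge0.
  by rewrite (le_trans tt').
have near_axis t : t1 <= t <= t2 -> exists2 z, axis z & mdist (gam t) z <= 22 * C.
  move=> /andP[t1t tt2]; have [r rt] := axis_proj (gam t); exists r; first by case: rt.
  have := contr_gromov geodX cZ rt px.1; have := contr_gromov geodX cZ rt qy.1.
  have := mdist_tri (gam t1) (gam t) p; have := mdist_tri (gam t2) (gam t) q.
  rewrite (metric_sym (gam t) (gam t1)) !dd; try lra.
  have := mdist_tri r p q; rewrite (metric_sym p r).
  have := mdist_tri p (gam t1) (gam t2); have := mdist_tri q (gam t1) (gam t2).
  have := mdist_tri (gam t1) p q; have := mdist_tri (gam t2) (gam t1) q.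
  rewrite dd; try lra.
  rewrite (metric_sym q (gam t2)) (metric_sym p (gam t1)).
  have := mdist_tri q p (gam t2); rewrite (metric_sym q (gam t2)).
  lra.
have near_gaxis t : 0 <= t <= L -> exists2 z, axis z & mdist (gam t) (act g z) <= 2 * C.
  move=> tL; have cY := contr_translate isoA g cZ.
  have [_ /(_ (gam t))[r rt] _] := cY.
  have [[z Zz zr] _] := rt; exists z => //; rewrite zr.
  have /(contr_gromov geodX cY rt) : (act g @` axis) (act g x) by exists x.
  have /(contr_gromov geodX cY rt) : (act g @` axis) (act g y) by exists y.
  have := mdist_tri r (act g x) (act g y).
  rewrite (metric_sym (gam t) (act g x)) from0// toL// L_E (metric_sym (act g x) r); lra.
pose t k : R := t1 + k%:R * sg.
have tP k : (k <= size s)%N -> t1 <= t k <= t2.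
  move=> ks; have : k%:R * sg <= (size s)%:R * sg by rewrite ler_wpM2r ?ler_nat// ltW.
  have : 0 <= k%:R * sg by rewrite mulr_ge0// ltW.
  rewrite /t /t2; lra.
have /choice[A AP] k : exists i : int * int, (k <= size s)%N ->
    mdist (gam (t k)) (act g (act (a i.1) o)) <= 2 * C /\
    mdist (gam (t k)) (act (a i.2) o) <= 22 * C.
  have [ks|] := leqP k (size s); last by exists (0, 0).
  have tk := tP _ ks.
  have [_ [j _ <-] jP] := near_axis _ tk.
  have [|_ [i _ <-] iP] := near_gaxis (t k); first lra.
  by exists (i, j).
have [k ks|i [j [ij js eqij]]] := @pigeonhole _ s
    (fun k => (a (- (A k).2) * (g * a (A k).1))%g).
  have [k1 k2] := AP _ ks.
  suff : [set g | ell g <= 24 * C] (a (- (A k).2) * (g * a (A k).1))%g by rewrite sE.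
  rewrite /= expgzN -mdist_orbit// actM//.
  have := mdist_tri (gam (t k)) (act (a (A k).2) o) (act g (act (a (A k).1) o)).
  rewrite (metric_sym (act (a (A k).2) o) (gam _)); lra.
have [ik1 ik2] := AP _ (ltnW (leq_trans ij js)); have [jk1 jk2] := AP _ js.
have ti := tP _ (ltnW (leq_trans ij js)); have tj := tP _ js.
have dij : sg <= mdist (gam (t i)) (gam (t j)).
  have tij : sg <= t j - t i.
    rewrite /t opprD addrACA subrr add0r -mulrBl -natrB 1?ltnW//.
    by rewrite ler_peMl ?ler1n ?subn_gt0 ?(ltW sg0).
  by rewrite dd//; lra.
exists ((A j).1 - (A i).1), ((A j).2 - (A i).2); split.
- apply/eqP => /eqP; rewrite subr_eq0 => /eqP eqA; rewrite eqA in jk1.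
  have := mdist_tri (act g (act (a (A i).1) o)) (gam (t i)) (gam (t j)).
  rewrite (metric_sym (act g _) (gam (t j))); move: dij; rewrite /sg; lra.
- apply/eqP => /eqP; rewrite subr_eq0 => /eqP eqA; rewrite eqA in jk2.
  have := mdist_tri (act (a (A i).2) o) (gam (t i)) (gam (t j)).
  rewrite (metric_sym (act _ o) (gam (t j))); move: dij; rewrite /sg; lra.
- apply: (@mulIg _ (a (A i).1)); rewrite -!mulgA -expgzD subrK.
  by rewrite [a ((A j).2 - _)]expgzD -mulgA eqij mulgA -expgzD subrr mul1g.
Qed.

(** Over [K] indices the chain moves by no more than its distance to the axis, so by contraction the
    projection moves by at most [C]. *)
Lemma chain_projection (K : nat) r (v : nat -> X) N :
  (0 < K)%N ->
  (forall i j, (i <= j)%N -> (j - i <= K)%N -> mdist (v i) (v j) <= r) ->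
  (forall i, (0 < i < N)%N -> forall p, is_proj axis (v i) p -> r <= mdist (v i) p) ->
  forall n i p q, (0 < i)%N -> (i + n < N)%N ->
  is_proj axis (v i) p -> is_proj axis (v (i + n)%N) q ->
  mdist p q <= C * ((n %/ K)%:R + 1).
Proof.
move=> K0 vK far; elim/ltn_ind => n IH i p q i0 inN ip iq.
have C0 := C_gt0; have [_ _ cZ'] := cZ.
have iN : (0 < i < N)%N by lia.
have [nK|Kn] := ltnP n K.
  rewrite divn_small// add0r mulr1; apply: (cZ' _ _ _ _ ip iq).
  by rewrite (le_trans _ (far _ iN _ ip))// vK//; lia.
have [q' q'i] := axis_proj (v (i + K)%N).
have pq' : mdist p q' <= C.
  by apply: (cZ' _ _ _ _ ip q'i); rewrite (le_trans _ (far _ iN _ ip))// vK//; lia.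
have : mdist q' q <= C * (((n - K) %/ K)%:R + 1).
  apply: (IH (n - K)%N _ (i + K)%N) => //; try lia.
  by have -> : (i + K + (n - K))%N = (i + n)%N by lia.
have -> : (n %/ K)%:R = ((n - K) %/ K)%:R + 1 :> R.
  by rewrite -{1}(subnK Kn) divnDr// divnn K0 natrD.
have := mdist_tri q' p q; nra.
Qed.

(** Large enough that the projection speed [C / chain_step] is at most half of the speed [lam^-1] of
    the chain; [chain_radius] is the displacement of a quasi-geodesic over that many steps. *)
Definition chain_step := (Num.bound (2 * lam * C)).+1.
Definition chain_radius := lam * chain_step%:R + c.

Lemma chain_radius_ge0 : 0 <= chain_radius.
Proof. by rewrite addr_ge0// mulr_ge0// (le_trans _ lam1). Qed.

(* A quasi-geodesic chain staying far from the axis is too long for its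
   projection to move as fast as the chain itself. *)
Lemma far_chain_short (v : nat -> X) N p q :
  (forall i j, (i <= j)%N -> lam^-1 * (j - i)%:R - c <= mdist (v i) (v j)
      <= lam * (j - i)%:R + c) ->
  (forall i, (0 < i < N)%N ->
     forall p, is_proj axis (v i) p -> chain_radius <= mdist (v i) p) ->
  is_proj axis (v 0%N) p -> is_proj axis (v N) q ->
  N%:R <= 2 * lam * (mdist (v 0%N) p + mdist (v N) q +
    (2 * chain_radius + 18 * C + 2 * lam + 3 * c)).
Proof.
move=> qv far p0 qN; have C0 := C_gt0; have rho0 := chain_radius_ge0.
have lam0 : 0 < lam by rewrite (lt_le_trans _ lam1).
have d0p := mdist_ge0 (v 0%N) p; have dNq := mdist_ge0 (v N) q.
have [N1|N2] := leqP N 1.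
  have : N%:R <= 1 :> R by rewrite lern1.
  have := lam1; have := c0; nra.
case: N far qN dNq N2 => [|[|N]]// far qN dNq _.
(* Only interior indices are assumed far from the axis, so the slow projection is used between [v 1]
   and [v N.+1], and the two end steps are paid through [proj_axis_lip]. *)
have /andP[lo _] := qv 0%N N.+2 isT; rewrite subn0 in lo.
have /andP[_ up1] := qv 0%N 1%N isT; rewrite subn0 mulr1 in up1.
have /andP[_ upN] := qv N.+1 N.+2 (leqnSn _); rewrite subSnn mulr1 in upN.
have [p1 p1P] := axis_proj (v 1%N); have [q1 q1P] := axis_proj (v N.+1).
have := proj_axis_lip p0 p1P; have := proj_axis_lip q1P qN.
have pq1 : mdist p1 q1 <= C * ((N %/ chain_step)%:R + 1).
  apply: (@chain_projection chain_step chain_radius v N.+2 isT _ far N 1%N p1 q1 isT _ p1P q1P).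
  - move=> i j ij jiK; have /andP[_ /le_trans] := qv i j ij; apply.
    by rewrite lerD2r ler_wpM2l ?ler_nat// ltW.
  - by rewrite add1n.
have step : C * (N %/ chain_step)%:R <= (2 * lam)^-1 * N.+2%:R.
  have K0 : 0 < chain_step%:R :> R by rewrite ltr0n.
  have CK : C <= (2 * lam)^-1 * chain_step%:R.
    rewrite ler_pdivlMl ?mulr_gt0//.
    apply/ltW/(lt_le_trans (archi_boundP _)); last by rewrite ler_nat.
    by rewrite !mulr_ge0// ltW.
  apply: (le_trans (ler_wpM2r (ler0n _ _) CK)).
  rewrite -mulrA ler_wpM2l ?invr_ge0 ?mulr_ge0 ?(ltW lam0)//.
  by rewrite -natrM ler_nat mulnC (leq_trans (leq_trunc_div _ _))// leqW.
have := mdist_tri p (v 0%N) (v N.+2); have := mdist_tri q p (v N.+2).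
have := mdist_tri p1 p q; have := mdist_tri q1 p1 q.
rewrite (metric_sym q (v N.+2)).
have lamE : lam^-1 = 2 * (2 * lam)^-1 by rewrite invfM mulVKf.
rewrite lamE in lo => t1 t2 t3 t4 t5 t6.
by rewrite -ler_pdivrMl ?mulr_gt0//; lra.
Qed.

Lemma intr_distn (k l : nat) : (k <= l)%N ->
  `|k%:Z - l%:Z|%:~R = (l - k)%:R :> R.
Proof. by move=> kl; have -> : `|k%:Z - l%:Z| = (l - k)%N%:Z by lia. Qed.

(** The chain [x h^n o] stays within a distance of the axis that depends on [x]. By
    [far_chain_short] it must come within [chain_radius] of the axis in both directions, and the
    excursion between these two visits around the index [0] has a length bounded independently of
    [x]. *)
Lemma elementary_near :
  exists r, forall x, E x -> exists k, ell (a (- k) * x)%g <= r.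
Proof.
have C0 := C_gt0; have rho0 := chain_radius_ge0; have c_ge0 := c0.
have lam0 : 0 < lam by rewrite (lt_le_trans _ lam1).
pose K1 := 2 * chain_radius + 18 * C + 2 * lam + 3 * c.
pose Nmax := 2 * lam * (2 * chain_radius + K1).
exists (lam * Nmax + c + chain_radius) => x [i [j [i0 j0 xij]]].
pose w (n : int) := act x (act (a n) o).
have qw m n : lam^-1 * `|m - n|%:~R - c <= mdist (w m) (w n) <= lam * `|m - n|%:~R + c.
  by rewrite /w mdist_act.
(* Divide [n] by [i] with quotient [q] and remainder [r]: since [x h^(iq) = h^(jq) x], the point
   [w n] equals [h^(jq) x h^r o], close to [h^(jq) o]. *)
have [D near] : exists D, forall n p, is_proj axis (w n) p -> mdist (w n) p <= D.
  exists (ell x + (lam * `|i|%:~R + c)) => n p [_ pmin].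
  apply: (le_trans (pmin _ (axis_pow (j * (n %/ i)%Z)))).
  rewrite {1}/w {1}(divz_eq n i) addrC expgzD expgzC mulrC actM// -actM//.
  rewrite (elementary_pow _ xij) actM// mdist_act// metric_sym -actM//.
  apply: (le_trans (lenM _ isoA _ _)); rewrite lerD2l.
  apply: (le_trans (len_pow_le _)); rewrite lerD2r ler_wpM2l ?(ltW lam0)//.
  by rewrite ler_int ger0_norm ?modz_ge0// ltW// ltz_mod.
have escape (e : int) : `|e| = 1 ->
    exists n : nat, `[< exists2 p, is_proj axis (w (e * n)) p & mdist (w (e * n)) p < chain_radius >].
  move=> e1; apply: contrapT => never.
  pose N := (Num.bound (2 * lam * (2 * D + K1))).+1.
  have [p p0] := axis_proj (w (e * 0%N)); have [q qN] := axis_proj (w (e * N)).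
  have := @far_chain_short (fun n : nat => w (e * n)) N p q _ _ p0 qN.
  have := near _ _ p0; have := near _ _ qN => qD pD short.
  suff : N%:R <= 2 * lam * (2 * D + K1).
    apply/negP; rewrite -ltNge (lt_trans (archi_boundP _)) ?ltr_nat//.
    rewrite !mulr_ge0 ?(ltW lam0)// addr_ge0 ?mulr_ge0 ?(le_trans _ pD) ?mdist_ge0//.
    by rewrite /K1; lra.
  apply: (le_trans (short _ _)).
  - move=> k l kl; have := qw (e * k) (e * l).
    by rewrite -mulrBr normrM e1 mul1r intr_distn.
  - move=> k kN r rk; rewrite leNgt; apply/negP => rlt; apply: never.
    by exists k; apply/asboolP; exists r.
  - by rewrite ler_wpM2l ?mulr_ge0 ?(ltW lam0)// /K1; lra.
case: (ex_minnP (escape 1 (normr1 _))) => np /asboolP[p pnp prho] npmin.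
case: (ex_minnP (escape (-1) (normrN1 _))) => nm /asboolP[q qnm qrho] nmmin.
have shortN : (nm + np)%:R <= Nmax.
  pose v (k : nat) := w (k%:Z - nm%:Z).
  have v0 : v 0%N = w (-1 * nm%:Z) by rewrite /v sub0r mulN1r.
  have vN : v (nm + np)%N = w (1 * np%:Z) by rewrite /v PoszD addrAC subrr add0r mul1r.
  rewrite -v0 in qnm qrho; rewrite -vN in pnp prho.
  apply: (le_trans (@far_chain_short v (nm + np)%N q p _ _ qnm pnp)).
  - move=> k l kl; have := qw (k%:Z - nm%:Z) (l%:Z - nm%:Z).
    by rewrite /v opprB addrA subrK intr_distn.
  - move=> k kN r rk; rewrite leNgt; apply/negP => rlt.
    have [nmk|knm] := leqP nm k.
      have ek : k%:Z - nm%:Z = 1 * (k - nm)%N%:Z by lia.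
      have /npmin : `[< exists2 p, is_proj axis (w (1 * (k - nm)%N%:Z)) p &
          mdist (w (1 * (k - nm)%N%:Z)) p < chain_radius >] by rewrite -ek; apply/asboolP; exists r.
      by lia.
    have ek : k%:Z - nm%:Z = -1 * (nm - k)%N%:Z by lia.
    have /nmmin : `[< exists2 p, is_proj axis (w (-1 * (nm - k)%N%:Z)) p &
        mdist (w (-1 * (nm - k)%N%:Z)) p < chain_radius >] by rewrite -ek; apply/asboolP; exists r.
    by lia.
  - by rewrite ler_wpM2l ?mulr_ge0 ?(ltW lam0)// /K1; lra.
have [[k _ kp] _] := pnp; exists k; rewrite expgzN -mdist_orbit// kp.
have /andP[_ up] := qw 0 (1 * np%:Z).
rewrite metric_sym; apply: (le_trans (mdist_tri (w (1 * np%:Z)) _ _)).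
rewrite /w /= act1// in up; apply: lerD; last exact: ltW.
rewrite (le_trans up)// lerD2r ler_wpM2l ?(ltW lam0)//.
rewrite mul1r sub0r normrN ger0_norm// (le_trans _ shortN)// ler_nat leq_addl//.
Qed.

Lemma expgz_neq1 n : n != 0 -> a n <> 1%g.
Proof.
move=> n0 an1; have lam0 : 0 < lam by rewrite (lt_le_trans _ lam1).
have bd (k : nat) : lam^-1 * k%:R <= c.
  have := len_pow (n * k%:Z); rewrite -expgzM an1.
  have -> : expgz 1%g k%:Z = 1%g :> G by rewrite /= expg1n.
  rewrite len1// lerBlDr add0r; apply: le_trans.
  have : k%:R <= `|n * k%:Z|%:~R :> R.
    rewrite normrM intrM -[X in X <= _]mul1r ler_wpM2r//.
    by rewrite (ler_int _ 1); lia.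
  by move=> kn; rewrite ler_wpM2l ?invr_ge0 ?(ltW lam0).
have := bd (Num.bound (lam * c)); apply/negP; rewrite -ltNge ltr_pdivlMl//.
by rewrite archi_boundP// mulr_ge0// (ltW lam0).
Qed.

Lemma expgz_inj : injective a.
Proof.
move=> m n amn; apply/eqP; rewrite -subr_eq0; apply/negPn/negP => /expgz_neq1.
by apply; rewrite expgzD expgzN amn mulgV.
Qed.

(** If [E] were everything, [elementary_near] applied to inverses would represent every left coset
    of [<h>] in a fixed ball, making [G] virtually Z. *)
Lemma exists_nonelementary : non_elementary G -> exists g, ~ E g.
Proof.
move=> [_ nvZ]; apply: contrapT => allE; apply: nvZ.
have {}allE g : E g by apply: contrapT => ?; apply: allE; exists g.
have Kclosed : group_closed (fun x : G => `[< exists n, x = a n >]).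
  split; first by apply/asboolP; exists 0.
  move=> x y /asboolP[m ->] /asboolP[n ->]; apply/asboolP.
  by exists (m - n); rewrite expgzD expgzN.
exists (mkSub Kclosed); last first.
  exists a; split; [exact: expgzD | exact: expgz_inj |].
  apply/seteqP; split=> [_ [n _ <-]|x /asboolP[n ->]]; last by exists n.
  by apply/asboolP; exists n.
have [r rP] := elementary_near.
apply: (sub_finite_set _ (finite_image (fun b => left_coset b (mkSub Kclosed)) (ball_finite r))).
move=> _ [g _ <-]; have [k kr] := rP _ (allE g^-1%g).
exists (g * a k)%g => /=; first by rewrite -(lenV o isoA) invgM -expgzN.
apply/seteqP; split=> _ [_ /asboolP[n ->] <-].
  by exists (a (k + n)); [apply/asboolP; exists (k + n) | rewrite expgzD mulgA].
exists (a (n - k)); first by apply/asboolP; exists (n - k).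
by rewrite -mulgA -expgzD addrC subrK.
Qed.

(** Such an [x] moves [o] close to [h^j o] and moves [g o] close to the axis translated by [g],
    whose projection is bounded and close to that of [g o]. Hence [h^j o], and with it [x o], stays
    near [o]. *)
Lemma elementary_inter_finite g : ~ E g ->
  finite_set [set x | E x /\ E (g^-1 * x * g)%g].
Proof.
move=> nE; have [r rP] := elementary_near; have [B BP] := bounded_projection.
have C0 := C_gt0.
apply: (sub_finite_set _ (ball_finite (5 * ell g + 4 * r + 24 * C + B))) => x /= [Ex Ek].
have [j jr] := rP _ Ex; have [i ir] := rP _ Ek.
have [p pP] := axis_proj (act (x * g) o).
have [q qP] := axis_proj (act (g * a i) o).
have [s sP] := axis_proj (act g o).
have pq : mdist p q <= r + 8 * C.
  apply: (le_trans (proj_axis_lip pP qP)); rewrite lerD2r metric_sym mdist_orbit//.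
  by rewrite invgM -expgzN -mulgA [(g^-1 * _)%g]mulgA.
have qs : mdist q s <= B.
  apply: (BP _ nE (act (a i) o) o) sP; [exact: axis_pow | exact: axis_o |].
  by rewrite -actM.
have so : mdist s o <= 2 * ell g.
  have := sP.2 _ axis_o; have := mdist_tri (act g o) s o.
  by rewrite (metric_sym s (act g o)) (metric_sym (act g o) o) -/(ell g); lra.
have xj : mdist (act (a j) o) (act x o) <= r by rewrite mdist_orbit// -expgzN.
have xgx : mdist (act (x * g) o) (act x o) <= ell g.
  by rewrite mdist_orbit// invgM mulgVK lenV.
have := pP.2 _ (axis_pow j).
have := mdist_tri (act x o) (act (x * g) o) (act (a j) o).
have := mdist_tri (act (a j) o) o (act x o); rewrite -/(ell x).
have := mdist_tri s o (act (a j) o); have := mdist_tri q s (act (a j) o).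
have := mdist_tri p q (act (a j) o).
have := mdist_tri (act (x * g) o) p (act (a j) o).
rewrite (metric_sym o s) (metric_sym s q) (metric_sym q p) (metric_sym p (act (x * g) o)).
rewrite (metric_sym (act x o) (act (a j) o)).
by have := len_ge0 act o g; lra.
Qed.

(** The elements with all conjugates in [E] form a normal subgroup, finite by
    [elementary_inter_finite], hence trivial by maximality. *)
Lemma elementary_core_trivial p : non_elementary G ->
  maximal_finite_normal (triv_subgroup G) -> p <> 1%g ->
  exists g, ~ E (g^-1 * p * g)%g.
Proof.
move=> nonel [_ _ maxN] p1; apply: contrapT => allE; apply: p1.
have [g0 nE] := exists_nonelementary nonel.
pose F x := `[< forall g, E (g^-1 * x * g)%g >].
have Fclosed : group_closed (fun x : G => F x).
  split; first by apply/asboolP => g; rewrite mulg1 mulVg; exact: elementary1.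
  move=> x y /asboolP Fx /asboolP Fy; apply/asboolP => g.
  have := elementaryM (Fx g) (elementaryV (Fy g)).
  by rewrite !invgM invgK !mulgA mulgK.
have : carrier (mkSub Fclosed) `<=` carrier (triv_subgroup G).
  apply: maxN.
    apply: sub_finite_set (elementary_inter_finite nE) => x /asboolP Fx; split => //.
    by have := Fx 1%g; rewrite invg1 mul1g mulg1.
  move=> g; apply: val_inj; apply/funext => x /=; apply/asboolP/asboolP => Fx k.
    have := Fx (g^-1 * k)%g.
    by rewrite /conjg !invgM invgK !mulgA !mulgK.
  have := Fx (g * k)%g.
  by rewrite /conjg !invgM !mulgA.
move=> /(_ p); rewrite /carrier/= => Ftriv; apply/eqP/Ftriv/asboolP => g.
by apply: contrapT => ?; apply: allE; exists g.
Qed.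

(** Closeness to [o] of the projection of [x]; the point [x] itself may be far away. *)
Definition near T x := forall p, is_proj axis x p -> mdist p o <= T.

Lemma near_le T T' x : T <= T' -> near T x -> near T' x.
Proof. by move=> TT' nx p /nx /le_trans; apply. Qed.

Lemma near_lip T D x y : near T x -> mdist x y <= D -> near (T + D + 8 * C) y.
Proof.
move=> nx xy p py; have [q qx] := axis_proj x; have := nx _ qx.
have := proj_axis_lip py qx; rewrite (metric_sym y x).
have := mdist_tri q p o; lra.
Qed.

Lemma near_orbit g : near (2 * ell g) (act g o).
Proof.
move=> p [_ /(_ _ axis_o)]; have := mdist_tri (act g o) p o.
by rewrite (metric_sym p (act g o)) (metric_sym (act g o) o) -/(ell g); lra.
Qed.

Lemma near_pow n T x p : near T x -> is_proj axis (act (a n) x) p ->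
  mdist p (act (a n) o) <= T.
Proof.
move=> nx /(proj_pow (- n)); rewrite -actM// -expgzD addNr act1// => /nx.
by rewrite expgzN (mdist_actl isoA) invgK.
Qed.

Lemma len_pow_unbounded D : exists n0 : nat, forall n : nat,
  (n0 <= n)%N -> D < ell (a n%:Z).
Proof.
have lam0 : 0 < lam by rewrite (lt_le_trans _ lam1).
exists (Num.bound (lam * (`|D| + c))) => n nn0.
apply: lt_le_trans (len_pow _).
rewrite ltrBrDr mulrC ltr_pdivlMr//; apply: (@le_lt_trans _ _ (lam * (`|D| + c))).
  by rewrite mulrC ler_wpM2l ?(ltW lam0)// lerD2r ler_norm.
have pos : 0 <= lam * (`|D| + c) by rewrite mulr_ge0 ?(ltW lam0)// addr_ge0.
apply: lt_le_trans (archi_boundP pos) _.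
by rewrite [`|n%:Z|]ger0_norm// ler_nat.
Qed.

(** * Ping-pong with elements outside the commensurator *)

Section BoundedProjection.
Variable B : R.
Hypothesis BP : forall g, ~ E g -> forall x y p q, axis x -> axis y ->
  is_proj axis (act g x) p -> is_proj axis (act g y) q -> mdist p q <= B.

Lemma near_translate T g z : ~ E g -> near T (act g o) -> axis z ->
  near (T + B) (act g z).
Proof.
move=> nE ng Zz p pg; have [q qg] := axis_proj (act g o).
have := BP nE Zz axis_o pg qg; have := ng _ qg; have := mdist_tri q p o; lra.
Qed.

Lemma nonelementaryV g : ~ E g -> ~ E g^-1%g.
Proof. by move=> nE /elementaryV; rewrite invgK. Qed.

(** The basic ping-pong move. By [behrstock] for the axis and its translate by [g], either [act g x]
    projects near the projection of the translate, which is near [o], or [x] projects near the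
    projection of the axis translated by [g^-1], which the distance of [p] from [o] excludes. *)
Lemma near_step T g x p : ~ E g -> near T (act g o) -> near T (act g^-1%g o) ->
  is_proj axis x p -> T + B + 16 * C < mdist p o -> near (T + B + 16 * C) (act g x).
Proof.
move=> nE ng ngV px far q qgx; have C0 := C_gt0.
have [r rP] := axis_proj (act g p).
have [s sP] := axis_proj (act g^-1%g q).
have := near_translate nE ng px.1 rP.
have := near_translate (nonelementaryV nE) ngV qgx.1 sP.
have [] := @behrstock _ _ geodX C axis (act g @` axis) (act g x) q (act g p) r (act g s).
- exact: cZ.
- exact: contr_translate.
- exact: qgx.
- by apply/proj_translate.
- exact: rP.
- by rewrite -(actVK isoA g q); apply/proj_translate.
- by have := mdist_tri r q o; lra.
- by rewrite mdist_act//; have := mdist_tri s p o; lra.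
Qed.

Lemma near_alternative g : ~ E g -> forall x,
  near (2 * ell g + B + 16 * C) x \/ near (2 * ell g + B + 16 * C) (act g x).
Proof.
move=> nE x; have [|nx] := EM (near (2 * ell g + B + 16 * C) x); first by left.
right; have [p px] : exists p, is_proj axis x p /\ 2 * ell g + B + 16 * C < mdist p o.
  apply: contrapT => none; apply: nx => p px; rewrite leNgt; apply/negP => far.
  by apply: none; exists p.
apply: near_step px.1 px.2 => //; first exact: near_orbit.
by rewrite -(lenV o isoA g); exact: near_orbit.
Qed.

(** Otherwise all powers of the conjugate are uniformly close to [<h>]; two of them differ from
    powers of [h] by the same element, and then [g] commensurates [<h>]. *)
Lemma nonelementary_conj_gen g : ~ E g -> ~ E (g * h * g^-1)%g.
Proof.
move=> nE Ek; apply: nE; have [r rP] := elementary_near.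
have /finite_seqP[s sE] := ball_finite r.
have Ekn (n : nat) : E (expgz (g * h * g^-1)%g n%:Z).
  by elim: n => [|n IH]; [exact: elementary1 | rewrite /= expgS; exact: elementaryM].
have /choice[k kP] n := rP _ (Ekn n).
have [n ns|i [j [ij _ eqij]]] := @pigeonhole _ s
    (fun n : nat => (a (- k n) * expgz (g * h * g^-1)%g n%:Z)%g).
  suff : [set g | ell g <= r] (a (- k n) * expgz (g * h * g^-1)%g n%:Z)%g by rewrite sE.
  exact: kP.
have rel : (g * a (j%:Z - i%:Z) = a (k j - k i) * g)%g.
  apply: (@mulIg _ g^-1%g); rewrite mulgK -expgz_conj.
  apply: (@mulIg _ (expgz (g * h * g^-1)%g i%:Z)); rewrite -expgzD subrK.
  by rewrite [a (k j - k i)]expgzD -[RHS]mulgA eqij [RHS]mulgA -expgzD subrr mul1g.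
have ji0 : j%:Z - i%:Z != 0 by lia.
exists (j%:Z - i%:Z), (k j - k i); split => //; apply/eqP => kji.
apply: (expgz_neq1 ji0); apply: (@mulgI _ g); rewrite rel kji.
by rewrite /= mul1g mulg1.
Qed.

(** The candidates are [1], [g] and [g * h]. The elements [g], [g * h] and [g * h * g^-1] carrying
    one candidate to another lie outside [E], so by [near_alternative] each point rejects at most
    one candidate, and two points leave one. *)
Lemma good_corrections : non_elementary G -> exists (cs : seq G) T,
  forall x y, exists2 k, k \in cs & near T (act k x) /\ near T (act k y).
Proof.
move=> /exists_nonelementary[g nE].
have nEgh : ~ E (g * h)%g.
  by move=> /elementaryMr Eg; apply/nE/Eg; exact: (elementary_expgz h 1).
have nEghg := nonelementary_conj_gen nE.
pose D := ell g + ell (g * h)%g + ell (g * h * g^-1)%g.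
exists [:: 1; g; g * h]%g, (2 * D + B + 16 * C).
have C0 := C_gt0; have l1 := len_ge0 act o g; have l2 := len_ge0 act o (g * h)%g.
have l3 := len_ge0 act o (g * h * g^-1)%g.
have alt12 x : near (2 * D + B + 16 * C) (act 1%g x) \/
               near (2 * D + B + 16 * C) (act g x).
  rewrite act1//; have [nx|nx] := near_alternative nE x; [left | right];
    by apply: near_le nx; rewrite /D; lra.
have alt13 x : near (2 * D + B + 16 * C) (act 1%g x) \/
               near (2 * D + B + 16 * C) (act (g * h)%g x).
  rewrite act1//; have [nx|nx] := near_alternative nEgh x; [left | right];
    by apply: near_le nx; rewrite /D; lra.
have alt23 x : near (2 * D + B + 16 * C) (act g x) \/
               near (2 * D + B + 16 * C) (act (g * h)%g x).
  have [nx|nx] := near_alternative nEghg (act g x); [left | right].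
    by apply: near_le nx; rewrite /D; lra.
  by move: nx; rewrite -actM// mulgVK; apply: near_le; rewrite /D; lra.
move=> x y; have := alt12 x; have := alt13 x; have := alt23 x.
have := alt12 y; have := alt13 y; have := alt23 y.
have in1 : 1%g \in [:: 1; g; g * h]%g by rewrite !inE eqxx.
have in2 : g \in [:: 1; g; g * h]%g by rewrite !inE eqxx orbT.
have in3 : (g * h)%g \in [:: 1; g; g * h]%g by rewrite !inE eqxx !orbT.
move=> y23 y13 y12 x23 x13 x12.
have [x1|nx1] := EM (near (2 * D + B + 16 * C) (act 1%g x)).
  have [y1|ny1] := EM (near (2 * D + B + 16 * C) (act 1%g y)).
    by exists 1%g.
  case: y12 => // y2; case: y13 => // y3; case: x23 => x'.
    by exists g.
  by exists (g * h)%g.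
case: x12 => // x2; case: x13 => // x3; case: y23 => y'.
  by exists g.
by exists (g * h)%g.
Qed.

(** The point [h^n g o] projects near [h^n o], far from [o], so [p] sends it to a point projecting
    near [o]. If the conjugate were in [E], that image would be close to some [h^n g h^i o], which
    projects near [h^n o]. *)
Lemma nonelementary_conj_pow p g : ~ E p -> ~ E g ->
  exists n0 : nat, forall n : nat, (n0 <= n)%N ->
    ~ E ((a n%:Z * g)^-1 * p * (a n%:Z * g))%g.
Proof.
move=> nEp nEg; have [r rP] := elementary_near; have C0 := C_gt0.
have [n0 n0P] := len_pow_unbounded (2 * ell g + 2 * B + r + 24 * C + 2 * ell p).
have B0 : 0 <= B.
  have [s sP] := axis_proj (act p o).
  by rewrite (le_trans _ (BP nEp axis_o axis_o sP sP))// mdistxx.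
exists n0 => n nn0 /rP[i ir]; have big := n0P _ nn0.
have r0 : 0 <= r by rewrite (le_trans _ ir)// len_ge0.
have gn : near (2 * ell g) (act g o) := @near_orbit g.
have [q qP] := axis_proj (act (a n%:Z) (act g o)).
have qn := near_pow gn qP.
have [q1 q1P] := axis_proj (act p (act (a n%:Z) (act g o))).
have [q2 q2P] := axis_proj (act (a n%:Z) (act g (act (a i) o))).
have q2n := near_pow (near_translate nEg gn (axis_pow i)) q2P.
have q12 : mdist q1 q2 <= r + 8 * C.
  apply: (le_trans (proj_axis_lip q1P q2P)); rewrite lerD2r -!actM// metric_sym mdist_orbit//.
  by apply: le_trans ir; rewrite expgzN !invgM !mulgA.

have tri1 := mdist_tri q o (act (a n%:Z) o); rewrite -/(ell (a n%:Z)) in tri1.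
have : near (2 * ell p + B + 16 * C) (act p (act (a n%:Z) (act g o))).
  apply: near_step qP _ => //; first exact: near_orbit.
    by rewrite -(lenV o isoA p); exact: near_orbit.
  by rewrite (metric_sym q o); have := len_ge0 act o p; lra.
move=> /(_ _ q1P); have := mdist_tri q1 o (act (a n%:Z) o); rewrite -/(ell (a n%:Z)).
have := mdist_tri q2 q1 (act (a n%:Z) o); rewrite (metric_sym o q1); lra.
Qed.

(** If some [h^r] commutes with [p], conjugating by powers of [h^r] changes nothing. Otherwise the
    elements [h^-n p h^n] of [E] are distinct, and only finitely many of them stay in [E] after
    conjugation by [g]. *)
Lemma elementary_conj_pow p g : E p -> ~ E g -> ~ E (g^-1 * p * g)%g ->
  exists r n0 : nat, (0 < r)%N /\ forall n : nat, (n0 <= n)%N ->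
    ~ E ((a (r * n)%N%:Z * g)^-1 * p * (a (r * n)%N%:Z * g))%g.
Proof.
move=> Ep nEg nEpg.
have [[r [r0 comm]]|ncomm] := EM (exists r : nat, (0 < r)%N /\
    (a r%:Z * p = p * a r%:Z)%g).
  exists r, 0%N; split => // n _; apply: contra_not nEpg.
  have := elementary_pow n%:Z (esym comm : (p * expgz h r%:Z = expgz h r%:Z * p)%g).
  rewrite -PoszM => comm'.
  set b := a (r * n)%N%:Z in comm' *.
  have -> // : ((b * g)^-1 * p * (b * g) = g^-1 * p * g)%g.
  by rewrite invgM -!mulgA (mulgA p) comm' -(mulgA b) mulKg.
pose f (n : nat) := ((a n%:Z)^-1 * p * a n%:Z)%g.
have finj : injective f.
  have wlogf m n : (m < n)%N -> f m <> f n.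
    move=> mn fmn; apply: ncomm; exists (n - m)%N; split; first by rewrite subn_gt0.
    have -> : ((n - m)%N : int) = n%:Z - m%:Z by lia.
    apply: (@mulIg _ (a m%:Z)); rewrite -!mulgA -expgzD subrK.
    rewrite [a (n%:Z - _)]expgzD expgzN -mulgA.
    have -> : ((a m%:Z)^-1 * (p * a m%:Z) = f m)%g by rewrite /f mulgA.
    by rewrite fmn /f -!mulgA mulVKg.
  move=> m n fmn; have [/wlogf /(_ fmn)|/wlogf /(_ (esym fmn))|] := ltngtP m n => //.
have /finite_seqP[s sE] : finite_set [set n | E (f n) /\ E (g^-1 * f n * g)%g].
  have := finite_preimage (in2W finj) (elementary_inter_finite nEg).
  by apply: sub_finite_set.
exists 1%N, (\max_(n <- s) n).+1; split => // n nn0 En.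
have : [set n | E (f n) /\ E (g^-1 * f n * g)%g] n.
  split; last by move: En; rewrite mul1n invgM /f !mulgA.
  apply: elementaryM; last exact: elementary_expgz.
  by apply: elementaryM => //; apply: elementaryV; exact: elementary_expgz.
by rewrite sE /= => /(@leq_bigmax_seq _ _ xpredT id) => /(_ isT); rewrite leqNgt nn0.
Qed.

(** Conjugating by a [g] that moves the new element out of [E] could bring the old ones back in. A
    large power of [h] placed before [g] prevents this, and the power is taken a multiple of [r] to
    keep the new element outside. *)
Lemma exists_transverse_conj (P : seq G) : non_elementary G ->
  maximal_finite_normal (triv_subgroup G) -> 1%g \notin P ->
  exists d, forall p, p \in P -> ~ E (d * p * d^-1)%g.
Proof.
move=> nonel maxN; elim: P => [|p0 P IH]; first by exists 1%g.
rewrite inE negb_or => /andP[p01 /IH[d dP]].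
set p0' := (d * p0 * d^-1)%g.
have [Ep0|nEp0] := EM (E p0'); last first.
  by exists d => p; rewrite inE => /orP[/eqP ->|/dP].
have [|g nEg'] := @elementary_core_trivial p0' nonel maxN.
  by move=> p01'; move: p01; rewrite -(mulKg d p0) -[X in (_ * X)%g](mulgK d^-1%g) invgK
    -/p0' p01' mul1g mulVg eqxx.
have nEg : ~ E g.
  by move=> Eg; apply/nEg'/elementaryM => //; apply: elementaryM => //; exact: elementaryV.
have [r [n0 [r0 nP0]]] := elementary_conj_pow Ep0 nEg nEg'.
have [n1 nP1] : exists n1 : nat, forall n : nat, (n1 <= n)%N -> forall p, p \in P ->
    ~ E ((a n%:Z * g)^-1 * (d * p * d^-1) * (a n%:Z * g))%g.
  elim: P dP {IH} => [|p P IH] dP; first by exists 0%N.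
  have [|n1 nP1] := IH; first by move=> q qP; apply: dP; rewrite inE qP orbT.
  have [n2 nP2] := nonelementary_conj_pow (dP p (mem_head _ _)) nEg.
  exists (maxn n1 n2) => n; rewrite geq_max => /andP[nn1 nn2] q.
  by rewrite inE => /orP[/eqP -> |]; [exact: nP2 | exact: nP1].
pose n := maxn n0 n1.
exists ((a (r * n)%N%:Z * g)^-1 * d)%g => p; rewrite inE => /orP pP.
have -> : ((a (r * n)%N%:Z * g)^-1 * d * p * ((a (r * n)%N%:Z * g)^-1 * d)^-1)%g =
   ((a (r * n)%N%:Z * g)^-1 * (d * p * d^-1) * (a (r * n)%N%:Z * g))%g.
  by rewrite [X in (_ * X)%g = _]invgM invgK !mulgA.
case: pP => [/eqP ->|pP]; first by apply: nP0; rewrite leq_maxl.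
apply: nP1 pP; rewrite (leq_trans (leq_maxr n0 n1))// leq_pmull//.
Qed.

Lemma geodesic_near_proj g x y p q L gam : geodesic L gam ->
  gam 0 = act g x -> gam L = act g y -> is_proj axis x p -> is_proj axis y q ->
  8 * C < mdist p q ->
  (exists t, 0 <= t <= L /\ mdist (gam t) (act g p) <= 10 * C) /\
  (exists t, 0 <= t <= L /\ mdist (gam t) (act g q) <= 10 * C).
Proof.
move=> [L0 isog] g0 gL px qy far; have C0 := C_gt0.
have L_E : mdist x y = L.
  rewrite -(mdist_act isoA g) -g0 -gL isog ?in_itv/= ?lexx ?L0//.
  by rewrite sub0r normrN ger0_norm.
have lower := @proj_sym_far _ _ geodX _ _ _ _ _ _ cZ px qy.
have p0 := mdist_ge0 x p; have q0 := mdist_ge0 q y.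
have {}lower : mdist x p + mdist p q + mdist q y - 8 * C <= L.
  by rewrite -L_E; apply: lower; lra.
have split t : 0 <= t <= L -> mdist x (act g^-1%g (gam t)) = t /\
    mdist (act g^-1%g (gam t)) y = L - t.
  move=> /andP[t0 tL]; rewrite [mdist x _]metric_sym !(mdist_actl isoA) invgK -g0 -gL.
  rewrite !isog ?in_itv/= ?lexx ?L0 ?t0 ?tL// subr0 ger0_norm//.
  by rewrite distrC ger0_norm// subr_ge0.
split.
  have tL : 0 <= mdist x p <= L by lra.
  have [e1 e2] := split _ tL; exists (mdist x p); split=> //.
  rewrite -(mdist_act isoA g^-1%g) actK//.
  by apply: (proj_on_geodesic geodX cZ px qy); [lra | | lra].
have tL : 0 <= L - mdist q y <= L by lra.
have [e1 e2] := split _ tL; exists (L - mdist q y); split=> //.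
rewrite -(mdist_act isoA g^-1%g) actK//.
by apply: (proj_on_geodesic geodX cZ qy px); rewrite metric_sym;
  [lra | rewrite (metric_sym y q); lra |
   rewrite [X in _ + X = _]metric_sym (metric_sym y x); lra].
Qed.

(** * Inserting elements along a path and decoding the result *)

Section Insertion.
Variables (cs P : seq G) (d : G) (T Te Dc r eps : R) (N : nat).
Hypothesis cs_good : forall x y,
  exists2 k, k \in cs & near T (act k x) /\ near T (act k y).
Hypothesis dP : forall p, p \in P -> ~ E (d * p * d^-1)%g.
Hypothesis TeP : forall p, p \in P -> 2 * ell (d * p * d^-1)%g <= Te.
Hypothesis DcP : forall k, k \in cs -> ell k <= Dc.
Hypothesis rP : forall x, E x -> exists k, ell (a (- k) * x)%g <= r.
Hypotheses (T0 : 0 <= T) (Te0 : 0 <= Te) (Dc0 : 0 <= Dc) (B0 : 0 <= B)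
  (r0 : 0 <= r) (eps0 : 0 <= eps).

(** [T1] bounds projections after crossing [e], [T2] those of the pieces multiplied by correctors,
    and [Tinv] is the bound that survives one more insertion in front. A piece longer than [L1]
    stays outside [E] after correction; [rho] is the distance from a geodesic to the ends of an
    insertion. *)
Local Notation T1 := (Te + B + 16 * C).
Local Notation T2 := (T + Dc + 8 * C).
Local Notation Tinv := (T2 + B + 16 * C + 2 * Dc).
Local Notation L1 := (T2 + r + 2 * Dc).
Local Notation rho := (10 * C + Tinv + Dc).

(** [h^N] has to outweigh all projection errors; [4 * rho + eps] is what [inserted_head_close] loses
    when it undoes an insertion. *)
Hypothesis bigN :
  2 * Tinv + 2 * T1 + 40 * C + 4 * rho + eps + 2 * T + Dc < ell (a N%:Z).

Ltac constants :=
  have := C_gt0; have := T0; have := Te0; have := Dc0; have := B0;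
  have := r0; have := eps0; have := bigN.

Definition insert k p : G :=
  (k^-1 * a N%:Z * (d * p * d^-1) * a (- N%:Z) * k)%g.

Lemma nearV p : p \in P -> near Te (act (d * p * d^-1)%g o) /\
  near Te (act (d * p * d^-1)^-1%g o).
Proof.
move=> pP; split; apply: near_le (@near_orbit _); rewrite ?(lenV o isoA); exact: TeP.
Qed.

Lemma near_pow_far n x T' q : near T' x -> is_proj axis (act (a n) x) q ->
  ell (a n) - T' <= mdist q o.
Proof.
move=> nx qP; have := near_pow nx qP; have := mdist_tri q o (act (a n) o).
by rewrite -/(ell (a n)) (metric_sym o q); lra.
Qed.

Lemma len_powN n : ell (a (- n)) = ell (a n).
Proof. by rewrite expgzN lenV. Qed.

Lemma near_cross e T' x : ~ E e -> near Te (act e o) -> near Te (act e^-1%g o) ->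
  T' <= Tinv -> near T' x -> near T1 (act e (act (a (- N%:Z)) x)).
Proof.
move=> nE ne neV T'T nx; have [q qP] := axis_proj (act (a (- N%:Z)) x).
apply: (near_step nE ne neV qP); have := near_pow_far nx qP; rewrite len_powN.
constants; lra.
Qed.

Lemma T_le_Tinv : T <= Tinv.
Proof. by constants; lra. Qed.

(** A long element of [E] moves [o] close to a distant point of the axis, so the image could not
    project near [o]. *)
Lemma long_not_elementary k k' s : k \in cs -> k' \in cs ->
  near T (act (k * s)%g o) -> L1 < ell s -> ~ E (k * s * k'^-1)%g.
Proof.
move=> kc k'c ns Ls /rP[i ir].
have n2 : near T2 (act (k * s * k'^-1)%g o).
  apply: near_lip ns _; rewrite mdist_orbit// mulKg.
  by rewrite (lenV o isoA) DcP.
have [q qP] := axis_proj (act (k * s * k'^-1)%g o); have := n2 _ qP.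
have := qP.2 _ (axis_pow i); rewrite [X in _ <= X -> _]metric_sym mdist_orbit// -expgzN.
have := mdist_tri q (act (k * s * k'^-1)%g o) o.
rewrite [X in X <= _ -> _]metric_sym -/(ell _).
have : ell s <= ell (k * s * k'^-1)%g + 2 * Dc.
  have sE : s = (k^-1 * (k * s * k'^-1) * k')%g by rewrite !mulgA mulVg mul1g mulgVK.
  have := lenM o isoA (k^-1 * (k * s * k'^-1))%g k'.
  have := lenM o isoA k^-1%g (k * s * k'^-1)%g; rewrite (lenV o isoA k).
  have := DcP kc; have := DcP k'c.
  by rewrite -sE; lra.
lra.
Qed.

(** Reading the word from the right, [a (- N)] drives the projection far from [o], [e] brings it
    back, [a N] drives it away again, and [k * s * k'^-1], outside [E] because [s] is long, brings
    it back. *)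
Lemma near_insert k k' s p w : k \in cs -> k' \in cs -> p \in P -> L1 < ell s ->
  near T (act (k * s)%g o) -> near T (act (k' * s^-1)%g o) ->
  near Tinv (act (k' * w)%g o) ->
  near Tinv (act (k * (s * insert k' p * w))%g o).
Proof.
move=> kc k'c pP Ls ns nsV nw; have C0 := C_gt0.
have nE := long_not_elementary kc k'c ns Ls.
have -> : (k * (s * insert k' p * w) =
    k * s * k'^-1 * (a N%:Z * ((d * p * d^-1) * (a (- N%:Z) * (k' * w)))))%g.
  by rewrite /insert !mulgA.
have [ne neV] := nearV pP.
have cross := near_cross (dP pP) ne neV (lexx _) nw.
set e := (d * p * d^-1)%g in cross *.
rewrite (actM isoA (k * s / k')%g) (actM isoA (a N%:Z)) (actM isoA e).
rewrite (actM isoA (a (- N%:Z))).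
have [q qP] := axis_proj (act (a N%:Z) (act e (act (a (- N%:Z)) (act (k' * w)%g o)))).
have far := near_pow_far cross qP.
apply: near_le (@near_step T2 _ _ q nE _ _ qP _).
- by constants; lra.
- apply: near_lip ns _; rewrite mdist_orbit// mulKg.
  by rewrite (lenV o isoA) DcP.
- rewrite !invgM invgK mulgA; apply: near_lip nsV _; rewrite mdist_orbit// mulKg.
  by rewrite (lenV o isoA) DcP.
- by constants; lra.
Qed.

Local Notation K := (2 * T + T1 + 8 * C + Dc).

(** Seen from the axis translated by [s * k^-1], the two ends project near [o] and near [h^N o], and
    [proj_sym_far] adds up the distances. *)
Lemma insert_length k s p : k \in cs -> p \in P -> near T (act (k * s^-1)%g o) ->
  ell s + ell (a N%:Z) - K <= ell (s * insert k p)%g.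
Proof.
move=> kc pP ns; have [ne neV] := nearV pP.
have nk : near Tinv (act k o).
  by apply: near_le (@near_orbit k); have := DcP kc; constants; lra.
have cross := near_cross (dP pP) ne neV (lexx _) nk.
set e := (d * p * d^-1)%g in ne neV cross.
have [x xP] := axis_proj (act (k * s^-1)%g o).
have [y yP] := axis_proj (act (a N%:Z) (act e (act (a (- N%:Z)) (act k o)))).
have xo := ns _ xP; have yN := near_pow cross yP.
have := @proj_sym_far _ _ geodX _ _ _ _ _ _ cZ xP yP.
have -> : mdist (act (k / s)%g o) (act (a N%:Z) (act e (act (a (- N%:Z)) (act k o)))) =
    ell (s * insert k p)%g.
  by rewrite -!actM// mdist_orbit// invgM invgK /insert !mulgA.
have := mdist_tri x o (act (a N%:Z) o); have := mdist_tri y x (act (a N%:Z) o).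
have := mdist_tri x (act (k / s)%g o) o; rewrite [X in X <= _ + _ -> _]metric_sym.
have : ell s <= ell k + ell (k / s)%g.
  rewrite -(lenV o isoA s); have := lenM o isoA k^-1%g (k / s)%g.
  by rewrite mulKg (lenV o isoA k).
rewrite -/(ell (a N%:Z)) -/(ell (k / s)%g) (metric_sym o x) => s1 s2 s3 s4 s5.
have := mdist_ge0 y (act (a N%:Z) (act e (act (a (- N%:Z)) (act k o)))).
have := DcP kc; have : 6 * C < mdist x y by constants; lra.
by move=> /s5; constants; lra.
Qed.

(** The insertion runs along two translates of the axis. The one at [s * k^-1] pins the geodesic
    near [s], the one at [s * k^-1 * h^N * e] pins it near [s * insert k p]. *)
Lemma geodesic_near_insert k s p w L gam : k \in cs -> p \in P ->
  near T (act (k * s^-1)%g o) -> near Tinv (act (k * w)%g o) ->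
  geodesic L gam -> gam 0 = o -> gam L = act (s * insert k p * w)%g o ->
  (exists t, 0 <= t <= L /\ mdist (gam t) (act s o) <= rho) /\
  (exists t, 0 <= t <= L /\ mdist (gam t) (act (s * insert k p)%g o) <= rho).
Proof.
move=> kc pP ns nw geo g0 gL; have [ne neV] := nearV pP; have kD := DcP kc.
have cross := near_cross (dP pP) ne neV (lexx _) nw.
have crossV : near T1 (act (d * p * d^-1)^-1%g (act (a (- N%:Z)) (act (k * s^-1)%g o))).
  apply: near_cross (nonelementaryV (dP pP)) neV _ T_le_Tinv ns.
  by rewrite invgK.
have iE : insert k p = (k^-1 * a N%:Z * (d * p * d^-1) * a (- N%:Z) * k)%g by [].
set e := (d * p * d^-1)%g in ne neV cross crossV iE; clearbody e.
split.
  have [x xP] := axis_proj (act (k * s^-1)%g o).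
  have [y yP] := axis_proj (act (a N%:Z) (act e (act (a (- N%:Z)) (act (k * w)%g o)))).
  have xo := ns _ xP; have yN := near_pow cross yP.
  have [|||||[t [tL tx]] _] := @geodesic_near_proj (s * k^-1)%g
    (act (k * s^-1)%g o) (act (a N%:Z) (act e (act (a (- N%:Z)) (act (k * w)%g o))))
    x y L gam geo.
  - by rewrite g0 -actM// mulgA mulgVK mulgV act1.
  - by rewrite gL iE -!actM// !mulgA.
  - exact: xP.
  - exact: yP.
  - have := mdist_tri x o (act (a N%:Z) o); have := mdist_tri y x (act (a N%:Z) o).
    by rewrite -/(ell (a N%:Z)) (metric_sym o x); constants; lra.
  exists t; split => //; have := mdist_tri (act (s / k)%g x) (gam t) (act s o).
  have : mdist (act (s / k)%g x) (act s o) <= T + Dc.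
    rewrite (mdist_actl isoA) -actM// invgM invgK mulgVK.
    by have := mdist_tri o x (act k o); rewrite -/(ell k); lra.
  by constants; lra.
have [x xP] := axis_proj (act e^-1%g (act (a (- N%:Z)) (act (k * s^-1)%g o))).
have [y yP] := axis_proj (act (a (- N%:Z)) (act (k * w)%g o)).
have xo := crossV _ xP; have yN := near_pow nw yP.
have [|||||_ [t [tL ty]]] := @geodesic_near_proj (s * k^-1 * a N%:Z * e)%g
  (act e^-1%g (act (a (- N%:Z)) (act (k * s^-1)%g o))) (act (a (- N%:Z)) (act (k * w)%g o))
  x y L gam geo.
- by rewrite g0 -!actM// expgzN !mulgA !mulgK mulgVK mulgV act1.
- by rewrite gL iE -!actM// !mulgA.
- exact: xP.
- exact: yP.
- have := mdist_tri x o (act (a (- N%:Z)) o); have := mdist_tri y x (act (a (- N%:Z)) o).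
  by rewrite -/(ell (a (- N%:Z))) len_powN (metric_sym o x); constants; lra.
exists t; split => //.
have := mdist_tri (act (s / k * a N%:Z * e)%g y) (gam t) (act (s * insert k p)%g o).
have : mdist (act (s / k * a N%:Z * e)%g y) (act (s * insert k p)%g o) <= Tinv + Dc.
  have -> : (s * insert k p)%g = (s / k * a N%:Z * e * (a (- N%:Z) * k))%g.
    by rewrite iE !mulgA.
  rewrite (actM isoA _ (a (- N%:Z) * k)%g) mdist_act//.
  have := mdist_tri (act (a (- N%:Z)) o) y (act (a (- N%:Z) * k)%g o).
  by rewrite mdist_orbit// mulKg; lra.
by constants; lra.
Qed.

Definition almost_minimal (H : set G) (y x : G) :=
  forall z, H z -> ell (y^-1 * x)%g <= ell (y^-1 * z * x)%g + eps.

(* [inserted H y l w]: the word [w] is obtained from the path through the points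
   [l] starting at [y], written relatively to [y], by inserting at each
   intermediate point [x] an element [f] with [x f x^-1] in [H]. *)
Inductive inserted (H : set G) : G -> seq G -> G -> Prop :=
| inserted_last y v : almost_minimal H y v -> inserted H y [:: v] (y^-1 * v)%g
| inserted_cons y x x' l k p w :
    L1 < ell (y^-1 * x)%g -> almost_minimal H y x -> k \in cs -> p \in P ->
    near T (act (k * (y^-1 * x)^-1)%g o) -> near T (act (k * (x^-1 * x'))%g o) ->
    H (x * insert k p * x^-1)%g -> inserted H x (x' :: l) w ->
    inserted H y (x :: x' :: l) (y^-1 * x * insert k p * w)%g.

Lemma inserted_near H y l w : inserted H y l w -> forall x l', l = x :: l' ->
  forall k, k \in cs -> near T (act (k * (y^-1 * x))%g o) ->
  near Tinv (act (k * w)%g o).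
Proof.
elim=> {y l w} [y v _|y x x' l k p w Lx _ kc pP nV n' _ _ IH] z l' [<- _] k' k'c nk'.
  exact: near_le T_le_Tinv nk'.
exact: near_insert (IH _ _ erefl _ kc n').
Qed.

Lemma inserted_inv H y x x' l w : inserted H y (x :: x' :: l) w ->
  exists k p w', [/\ k \in cs, p \in P, w = (y^-1 * x * insert k p * w')%g &
    [/\ almost_minimal H y x, near T (act (k * (y^-1 * x)^-1)%g o),
     near Tinv (act (k * w')%g o), H (x * insert k p * x^-1)%g &
     inserted H x (x' :: l) w']].
Proof.
move=> ins; inversion ins as [|? ? ? ? k p w' _ am kc pP nV n' Hx insx]; subst.
exists k, p, w'; split => //; split => //.
exact: (inserted_near insx erefl kc n').
Qed.

Variable Fm : R.
Hypothesis FmP : forall k p, k \in cs -> p \in P -> ell (insert k p) <= Fm.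
Local Notation L2 := (Fm + 4 * rho).

(* If the geodesic to [w o] visited [x] long before [z], then undoing the insertion
   at [x], which multiplies [z] by an element of [H], would shorten [z]. *)
Lemma inserted_head_close (H : set G) y x x' l z z' l' w :
  (forall g, H g -> H g^-1%g) ->
  inserted H y (x :: x' :: l) w -> inserted H y (z :: z' :: l') w ->
  ell (x^-1 * z)%g <= L2.
Proof.
move=> HV insx insz.
have [L [gam [geo g0 gL]]] := geodX o (act w o); have [L0 isog] := geo.
pose pos v t := 0 <= t <= L /\ mdist (gam t) (act (y^-1 * v)%g o) <= rho.
have dgam s t : 0 <= s <= L -> 0 <= t <= L -> mdist (gam s) (gam t) = `|s - t|.
  by move=> sL tL; rewrite isog// in_itv.
have close v v' t t' : pos v t -> pos v' t' -> `|t - t'| <= Fm + 2 * rho ->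
    ell (v^-1 * v')%g <= L2.
  move=> [tL vt] [tL' vt']; rewrite -dgam// => tt'.
  have -> : ell (v^-1 * v')%g = mdist (act (y^-1 * v)%g o) (act (y^-1 * v')%g o).
    by rewrite mdist_orbit// invgM invgK -mulgA mulVKg.
  have := mdist_tri (gam t) (act (y^-1 * v)%g o) (act (y^-1 * v')%g o).
  have := mdist_tri (gam t') (gam t) (act (y^-1 * v')%g o).
  by rewrite (metric_sym (act (y^-1 * v)%g o) (gam t)); lra.
have later v v' m u u' m' t t' : inserted H y [:: v, v' & m] w ->
    inserted H y [:: u, u' & m'] w -> pos v t -> pos u t' -> t + Fm + 2 * rho < t' -> False.
  move=> insv insu [tL vt] [tL' ut'] tt'.
  have [k [p [w' [kc pP wE [am nV n' Hv _]]]]] := inserted_inv insv.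
  have [_ [_ [_ [_ _ _ [amu _ _ _ _]]]]] := inserted_inv insu.
  rewrite {insv insu}wE in gL; set s := (y^-1 * v)%g in vt nV gL *.
  have [_ [t1 [t1L ft1]]] := geodesic_near_insert kc pP nV n' geo g0 gL.
  have long := insert_length kc pP nV; have fF := FmP kc pP.
  have dff : mdist (act s o) (act (s * insert k p)%g o) = ell (insert k p).
    by rewrite mdist_orbit// mulKg.
  have d0 t0 : 0 <= t0 <= L -> mdist o (gam t0) = t0.
    move=> t0L; rewrite -g0 dgam ?lexx ?L0// sub0r normrN ger0_norm//.
    by case/andP: t0L.
  have t1t' : t1 <= t'.
    have := mdist_tri (act s o) (gam t) (act (s * insert k p)%g o); rewrite dff.
    have := mdist_tri (act (s * insert k p)%g o) (gam t) (gam t1).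
    rewrite dgam// (metric_sym (act (s * _)%g o) (gam t1)); have := ler_norm (t1 - t).
    by rewrite distrC; lra.
  (* Applied to [u], this element of [H] gives a path that skips the insertion and saves
     [ell (a N)], up to [K + 4 * rho]; by [bigN] the saving exceeds [eps]. *)
  have /amu : H (v * insert k p * v^-1)^-1%g by exact: HV.
  have -> : (y^-1 * (v * insert k p / v)^-1 * u = s * (insert k p)^-1 * v^-1 * u)%g.
    by rewrite !invgM invgK /s !mulgA.
  have := lenM o isoA s ((insert k p)^-1 * v^-1 * u)%g; rewrite !mulgA.
  have -> : ell ((insert k p)^-1 * v^-1 * u)%g =
      mdist (act (s * insert k p)%g o) (act (y^-1 * u)%g o).
    by rewrite mdist_orbit// (invgM s) (invgM y^-1%g) invgK -!mulgA mulVKg.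
  have := mdist_tri (gam t1) (act (s * insert k p)%g o) (act (y^-1 * u)%g o).
  have := mdist_tri (gam t') (gam t1) (act (y^-1 * u)%g o).
  have := mdist_tri (act (y^-1 * u)%g o) o (gam t').
  have := mdist_tri (act (s * insert k p)%g o) o (gam t1).
  have := mdist_tri (gam t1) o (act (s * insert k p)%g o).
  rewrite (metric_sym (act (s * insert k p)%g o) (gam t1)) (metric_sym (act (y^-1 * u)%g o) (gam t')).
  rewrite dgam// distrC ger0_norm ?subr_ge0// !d0//.
  rewrite -/(ell (s * insert k p)%g) -/(ell (y^-1 * u)%g).
  constants; lra.
have [k [p [w' [kc pP wE [am nV n' _ _]]]]] := inserted_inv insx.
have [k2 [p2 [w2 [kc2 pP2 wE2 [am2 nV2 n2 _ _]]]]] := inserted_inv insz.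
have gLx : gam L = act (y^-1 * x * insert k p * w')%g o by rewrite -wE.
have gLz : gam L = act (y^-1 * z * insert k2 p2 * w2)%g o by rewrite -wE2.
have [[t [tL xt]] _] := geodesic_near_insert kc pP nV n' geo g0 gLx.
have [[t' [tL' zt']] _] := geodesic_near_insert kc2 pP2 nV2 n2 geo g0 gLz.
apply: (close x z t t') => //; rewrite leNgt; apply/negP => far.
have [tt'|t't] := leP t t'.
  apply: (later _ _ _ _ _ _ t t' insx insz) => //.
  by move: far; rewrite distrC ger0_norm ?subr_ge0//; lra.
apply: (later _ _ _ _ _ _ t' t insz insx) => //.
by move: far; rewrite gtr0_norm ?subr_gt0//; lra.
Qed.

Fixpoint admissible (D : R) (H : set G) (y : G) (l : seq G) : Prop :=
  match l with
  | [::] => False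
  | x :: l' => almost_minimal H y x /\
      (l' <> [::] -> D < ell (y^-1 * x)%g /\ admissible D H x l')
  end.

Fixpoint path_length (y : G) (l : seq G) : R :=
  if l is x :: l' then ell (y^-1 * x)%g + path_length x l' else 0.

Lemma inserted_exists (H : set G) : 0 <= Fm ->
  (forall g, exists2 p, p \in P & H (g * p * g^-1)%g) ->
  forall l y, admissible L1 H y l -> exists w, inserted H y l w /\
    ell w <= path_length y l + Fm * (size l)%:R.
Proof.
move=> Fm0 conf; elim=> [//|x [|x' l] IH] y [am adm].
  exists (y^-1 * x)%g; split; first exact: inserted_last.
  by rewrite /= addr0 lerDl mulr1.
have [Lx admx] : L1 < ell (y^-1 * x)%g /\ admissible L1 H x (x' :: l) by exact: adm.
have [w [ins ellw]] := IH x admx.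
have [k kc [nV n']] := cs_good (act (y^-1 * x)^-1%g o) (act (x^-1 * x')%g o).
(* The choice of [p] comes after that of [k]: conjugating [p] by this element gives exactly
   [x * insert k p * x^-1]. *)
have [p pP Hp] := conf (x * k^-1 * a N%:Z * d)%g.
exists (y^-1 * x * insert k p * w)%g; split.
  apply: inserted_cons => //; rewrite ?(actM isoA k)//.
  by move: Hp; rewrite /insert !invgM invgK expgzN !mulgA.
apply: (le_trans (lenM _ isoA _ _)).
have := lenM o isoA (y^-1 * x)%g (insert k p); have := FmP kc pP.
move: ellw; rewrite /= -[(size l).+2]addn1 natrD mulrDr mulr1; lra.
Qed.

Lemma size_flatten_le (U : Type) (n : nat) (ss : seq (seq U)) :
  all (fun s => size s <= n)%N ss -> (size (flatten ss) <= size ss * n)%N.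
Proof.
elim: ss => //= s ss IH /andP[sn /IH le]; rewrite size_cat mulSn.
exact: leq_add.
Qed.

(** Decoding: by [inserted_head_close] the first cut point lies in the ball of radius [L2] around
    that of one fixed path, and the inserted element is in the finite list [Fs]. Stripping both from
    [w] leaves the word of a shorter path; the final point is determined by [y] and [w]. *)
Lemma inserted_cover : exists Cm : nat, forall H : set G,
  (forall g, H g -> H g^-1%g) -> forall j y w, exists ls : seq (seq G),
    (size ls <= Cm ^ j)%N /\
    forall l, size l = j.+1 -> inserted H y l w -> l \in ls.
Proof.
have /finite_seqP[sb sbE] := ball_finite L2.
pose Fs := [seq insert k p | k <- cs, p <- P].
exists (size sb * size Fs)%N => H HV; elim=> [|j IH] y w.
  exists [:: [:: y * w]%g]; split => // -[|v []]// _ ins.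
  by inversion ins; subst; rewrite mulVKg mem_head.
have [[x0 [x0' [l0 ins0]]]|none] := EM (exists x x' l, inserted H y (x :: x' :: l) w);
  last first.
  exists [::]; split => // -[|x [|x' l]]// _ ins; exfalso; apply: none.
  by exists x, x', l.
have /choice[LS LSP] (xf : G * G) : exists ls : seq (seq G),
    (size ls <= (size sb * size Fs) ^ j)%N /\
    forall l, size l = j.+1 ->
      inserted H xf.1 l (xf.2^-1 * (y^-1 * xf.1)^-1 * w)%g -> l \in ls.
  exact: IH.
exists (flatten [seq flatten [seq map (cons (x0 * b)%g) (LS (x0 * b, f)%g) | f <- Fs]
                | b <- sb]); split.
  rewrite expnS -mulnA; apply: leq_trans (size_flatten_le (n := size Fs * (size sb * size Fs) ^ j) _) _.
    apply/allP => _ /mapP[b _ ->].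
    apply: leq_trans (size_flatten_le (n := (size sb * size Fs) ^ j) _) _.
      by apply/allP => _ /mapP[f _ ->]; rewrite size_map; case: (LSP (x0 * b, f)%g).
    by rewrite size_map.
  by rewrite size_map.
move=> [|x [|x' l]]// [sl] ins.
have [k [p [w' [kc pP wE [_ _ _ _ insx]]]]] := inserted_inv ins.
have xb : (x0^-1 * x)%g \in sb.
  suff : [set g | ell g <= L2] (x0^-1 * x)%g by rewrite sbE.
  exact: inserted_head_close HV ins0 ins.
have fF : insert k p \in Fs by apply/allpairsP; exists (k, p).
apply/flattenP; exists (flatten [seq map (cons (x0 * (x0^-1 * x))%g)
   (LS (x0 * (x0^-1 * x), f)%g) | f <- Fs]); first by apply/mapP; exists (x0^-1 * x)%g.
apply/flattenP; exists (map (cons (x0 * (x0^-1 * x))%g)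
   (LS (x0 * (x0^-1 * x), insert k p)%g)); first by apply/mapP; exists (insert k p).
rewrite mulVKg map_f//; have [_] := LSP (x, insert k p); apply => //=; first by rewrite sl.
by rewrite wE -mulgA -(mulgA (y^-1 * x)%g) mulKg mulKg.
Qed.
End Insertion.
End BoundedProjection.

Lemma seq_len_bound (s : seq G) : exists2 D, 0 <= D & forall g, g \in s -> ell g <= D.
Proof.
elim: s => [|g s [D D0 IH]]; first by exists 0.
exists (Num.max (ell g) D) => [|k]; first by rewrite le_max D0 orbT.
by rewrite inE => /orP[/eqP ->|/IH kD]; rewrite le_max ?lexx// kD orbT.
Qed.

(** The constants and the relation [ins] are chosen before [H]; this order makes the final rate
    uniform over [U]. *)
Lemma insertion (P : seq G) (eps : R) : non_elementary G ->
  maximal_finite_normal (triv_subgroup G) -> 1%g \notin P -> 0 <= eps ->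
  exists (D Fm : R) (Cm : nat) (ins : set G -> G -> seq G -> G -> Prop),
    0 <= Fm /\ forall H : set G, (forall g, H g -> H g^-1%g) ->
    (forall g, exists2 p, p \in P & H (g * p * g^-1)%g) ->
    (forall l y, admissible eps D H y l -> exists w, ins H y l w /\
       ell w <= path_length y l + Fm * (size l)%:R) /\
    (forall j y w, exists ls : seq (seq G), (size ls <= Cm ^ j)%N /\
       forall l, size l = j.+1 -> ins H y l w -> l \in ls).
Proof.
move=> nonel maxN P1 eps0.
have [B BP] := bounded_projection; have [r rP] := elementary_near.
have [d dP] := exists_transverse_conj BP nonel maxN P1.
have [cs [T csP]] := good_corrections BP nonel.
have [Te Te0 TeP] := seq_len_bound [seq (d * p * d^-1)%g | p <- P].
have [Dc Dc0 DcP] := seq_len_bound cs.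
have [g0 nE] := exists_nonelementary nonel.
have B0 : 0 <= B.
  have [s sP] := axis_proj (act g0 o).
  by rewrite (le_trans _ (BP _ nE _ _ _ _ axis_o axis_o sP sP))// mdistxx.
have T0 : 0 <= T.
  have [k _ [nk _]] := csP o o; have [s sP] := axis_proj (act k o).
  by rewrite (le_trans _ (nk _ sP))// mdist_ge0.
have r0 : 0 <= r.
  by have [k] := rP _ (elementary1 h); apply: le_trans; exact: len_ge0.
have C0 := C_gt0.
pose T1 := 2 * Te + B + 16 * C; pose T2 := T + Dc + 8 * C.
pose Tinv := T2 + B + 16 * C + 2 * Dc; pose rho := 10 * C + Tinv + Dc.
have [N NP] := len_pow_unbounded (2 * Tinv + 2 * T1 + 40 * C + 4 * rho + eps + 2 * T + Dc).
have bigN := NP _ (leqnn N).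
have [Fm Fm0 FmP] := seq_len_bound [seq insert d N k p | k <- cs, p <- P].
have FmP' k p : k \in cs -> p \in P -> ell (insert d N k p) <= Fm.
  by move=> kc pP; apply: FmP; apply/allpairsP; exists (k, p).
have TeP' p : p \in P -> 2 * ell (d * p * d^-1)%g <= 2 * Te.
  by move=> pP; rewrite ler_pM2l// TeP//; apply/mapP; exists p.
have Te0' : 0 <= 2 * Te by rewrite mulr_ge0.
have [Cm CmP] := @inserted_cover B BP cs P d T (2 * Te) Dc r eps N dP TeP' DcP rP
  T0 Te0' Dc0 B0 r0 eps0 bigN Fm FmP'.
exists (T2 + r + 2 * Dc), Fm, Cm, (inserted cs P d T Dc r eps N); split => // H HV conf.
split; last exact: CmP HV.
exact: (inserted_exists csP FmP' Fm0 conf).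
Qed.
End ContractingElement.

(** * Uniformly recurrent subgroups *)

Section UniformlyRecurrent.
Variable G : groupType.
Implicit Types (H : subgroup_space G) (U : set (subgroup_space G)).

Lemma carrier1 H : carrier H 1%g.
Proof. by have [] : group_closed (fun x : G => set_val H x) := set_valP H. Qed.

Lemma carrierV H x : carrier H x -> carrier H x^-1%g.
Proof.
by move=> Hx; apply: group_closedV Hx; exact: (set_valP H : group_closed _).
Qed.

Lemma carrier_conj g H x : carrier (conjSub g H) x = carrier H (x ^ g)%g.
Proof. by []. Qed.

Lemma open_value (x : G) (b : bool) : open [set k : {ptws G -> bool} | k x = b].
Proof.
have /continuousP : continuous ((fun k => k x) : {ptws G -> bool} -> bool).
  exact: (@proj_continuous G (fun _ => bool) x).
by move=> /(_ [set b]); apply; exact: discrete_open.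
Qed.

Lemma open_carrier (x : G) (b : bool) : open [set H : subgroup_space G | set_val H x = b].
Proof. by exists [set k : {ptws G -> bool} | k x = b]; first exact: open_value. Qed.

Lemma closure_trivial H : closure [set triv_subgroup G] H -> H = triv_subgroup G.
Proof.
move=> clH; apply: val_inj; apply/funext => x.
have /clH[K [-> eqx]] : nbhs H [set K | set_val K x = set_val H x].
  by apply: open_nbhs_nbhs; split; first exact: open_carrier.
exact: esym eqx.
Qed.

Lemma uniformly_recurrent_trivial U : uniformly_recurrent U ->
  U (triv_subgroup G) -> U = [set triv_subgroup G].
Proof.
move=> [_ _ _ Umin] Ut; apply/seteqP; split=> [H UH|_ ->//].
apply: closure_trivial; apply: closure_subset (Umin _ Ut _ UH) => _ [g _ <-].
apply: val_inj; apply/funext => x /=.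
by apply/eqP/eqP => [/eqP|->]; [rewrite conjg_eq1 => /eqP | rewrite conj1g].
Qed.

(* Compactness of [U]: subgroups in [U] avoiding larger and larger finite
   subsets of G \ {1} accumulate at the trivial subgroup. *)
Lemma confining_set U : uniformly_recurrent U -> U <> [set triv_subgroup G] ->
  exists2 P : seq G, 1%g \notin P &
    forall H g, U H -> exists2 p, p \in P & carrier H (g * p * g^-1)%g.
Proof.
move=> urU nontriv; have [_ closedU conjU _] := urU.
suff [P P1 PU] : exists2 P : seq G, 1%g \notin P &
    forall H, U H -> exists2 p, p \in P & carrier H p.
  exists P => // H g /(conjU g^-1%g)/PU[p pP]; rewrite carrier_conj => Hp.
  by exists p => //; move: Hp; rewrite /conjg invgK mulgA.
apply: contrapT => none; apply: nontriv; apply: uniformly_recurrent_trivial => //.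
pose A (P : seq G) := [set H | U H /\ forall p, p \in P -> ~ carrier H p].
have A0 P : 1%g \notin P -> exists H, A P H.
  move=> P1; apply: contrapT => noH; apply: none; exists P => // H UH.
  apply: contrapT => noP; apply: noH; exists H; split => // p pP Hp.
  by apply: noP; exists p.
(* The filter lives on [{0,1}^G], where Tychonoff applies, rather than on the subspace of subgroups;
   its cluster point is afterwards computed value by value. *)
pose F : set_system {ptws G -> bool} := [set S | exists P : seq G,
  1%g \notin P /\ forall H, A P H -> S (set_val H)].
have FF : ProperFilter F.
  split=> [[P [/A0[H AH] noH]]|]; first exact: noH AH.
  split=> [|S S' [P [P1 SP]] [Q [Q1 SQ]]|S S' SS' [P [P1 SP]]].
  - by exists [::].
  - exists (P ++ Q); rewrite mem_cat negb_or P1 Q1; split=> // H [UH PQ]; split.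
      by apply: SP; split=> // p pP; apply: PQ; rewrite mem_cat pP.
    by apply: SQ; split=> // p pQ; apply: PQ; rewrite mem_cat pQ orbT.
  - by exists P; split=> // H /SP; exact: SS'.
have compT : compact [set: {ptws G -> bool}].
  have := @tychonoff G (fun _ => bool) (fun _ => setT) (fun _ => bool_compact).
  by congr (compact _); apply/seteqP; split.
have [f [_ clf]] : [set: {ptws G -> bool}] `&` cluster F !=set0 := compT F FF filterT.
have f1 : f 1%g = true.
  have [k [k1 <-]] : [set k : {ptws G -> bool} | k 1%g] `&`
      [set k : {ptws G -> bool} | k 1%g = f 1%g] !=set0.
    apply: clf; last by apply: open_nbhs_nbhs; split; first exact: open_value.
    by exists [::]; split=> // H _; exact: carrier1.
  exact: k1.
have fx x : x != 1%g -> f x = false.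
  move=> x1; have [k [/negbTE kx <-]] : [set k : {ptws G -> bool} | ~~ k x] `&`
      [set k : {ptws G -> bool} | k x = f x] !=set0.
    apply: clf; last by apply: open_nbhs_nbhs; split; first exact: open_value.
    exists [:: x]; rewrite inE eq_sym x1; split=> // H [_ nHx].
    by apply/negP; apply: nHx; rewrite mem_head.
  exact: kx.
have fE : f = set_val (triv_subgroup G).
  apply/funext => x; have -> : set_val (triv_subgroup G) x = (x == 1%g) by [].
  by have [->|x1] := eqVneq x 1%g; [rewrite f1 | rewrite fx].
apply: contrapT => nUt; have [V openV VE] : open (~` U) by exact: closed_openC.
have Vf : V f.
  by rewrite fE; have : (set_val @^-1` V) (triv_subgroup G) by rewrite VE.
have [k [[H [UH <-]] VH]] : [set k | exists H, U H /\ set_val H = k] `&` V !=set0.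
  apply: clf; last exact: open_nbhs_nbhs.
  by exists [::]; split=> // H [UH _]; exists H.
by have : (~` U) H by rewrite -VE.
Qed.
End UniformlyRecurrent.

(** * Growth rates *)

Section Covers.
Variable R : realType.

(** Encodes that [A] has at most [r] elements for a real [r] ([counting_cov]), in a form stable
    under subsets, unions and images. *)
Definition cov (T : eqType) (A : set T) (r : R) :=
  exists2 s : seq T, A `<=` [set` s] & (size s)%:R <= r.

Lemma cov_sub (T : eqType) (A B : set T) r r' :
  A `<=` B -> r <= r' -> cov B r -> cov A r'.
Proof.
move=> AB rr' [s Bs sr]; exists s; first exact: subset_trans Bs.
exact: le_trans rr'.
Qed.

Lemma cov_setU (T : eqType) (A B : set T) r r' :
  cov A r -> cov B r' -> cov (A `|` B) (r + r').
Proof.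
move=> [s As sr] [t Bt tr]; exists (s ++ t); last by rewrite size_cat natrD lerD.
by move=> x [/As|/Bt] /= xs; rewrite mem_cat xs ?orbT.
Qed.

Lemma cov_image (T U : eqType) (f : T -> U) (A : set T) r : cov A r -> cov (f @` A) r.
Proof.
move=> [s As sr]; exists (map f s); last by rewrite size_map.
by move=> _ [x Ax <-] /=; apply/map_f/As.
Qed.

Lemma cov_finite (T : choiceType) (A : set T) r : cov A r -> finite_set A.
Proof. by move=> [s As _]; exact: sub_finite_set As (finite_seq s). Qed.

Lemma cov_size (T : choiceType) (A : set T) r (s : seq T) :
  cov A r -> uniq s -> {subset s <= [pred x | `[< A x >]]} -> (size s)%:R <= r.
Proof.
move=> [t At tr] us sA; apply: le_trans tr; rewrite ler_nat.
by apply: uniq_leq_size us _ => x /sA/asboolP/At.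
Qed.

Lemma cov_uniq (T : choiceType) (A : set T) r : cov A r ->
  exists s : seq T, [/\ uniq s, A = [set` s] & (size s)%:R <= r].
Proof.
move=> [t At tr]; pose s := undup [seq x <- t | `[< A x >]].
have mem_s x : x \in s <-> A x.
  rewrite mem_undup mem_filter; split=> [/andP[/asboolP]//|Ax].
  by rewrite (At x Ax) andbT; apply/asboolP.
exists s; split; first exact: undup_uniq.
  by apply/seteqP; split=> x /=; rewrite mem_s.
apply: (@cov_size _ A); [by exists t | exact: undup_uniq |].
by move=> x /mem_s Ax; apply/asboolP.
Qed.

Lemma mem_fset_set (T : choiceType) (A : set T) x : finite_set A ->
  x \in finmap.enum_fset (fset_set A) <-> A x.
Proof.
move=> finA; have -> : x \in finmap.enum_fset (fset_set A) = (x \in A).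
  exact: (in_fset_set finA x).
by rewrite inE.
Qed.

Lemma counting_cov (T : choiceType) (A : set T) (r : R) :
  (counting A <= r%:E)%E <-> cov A r.
Proof.
rewrite /counting; split.
  case: asboolP => [finA|_]; last by rewrite leNgt ltry.
  rewrite lee_fin => le_r; exists (finmap.enum_fset (fset_set A)) => // x Ax /=.
  exact/mem_fset_set.
move=> covA; rewrite asboolT; last exact: cov_finite covA.
have finA := cov_finite covA.
rewrite lee_fin; apply: cov_size covA (finmap.fset_uniq _) _.
by move=> x /(mem_fset_set x finA) Ax; apply/asboolP.
Qed.

Lemma counting_ge0 (T : choiceType) (A : set T) : (0%:E <= counting A :> \bar R)%E.
Proof. by rewrite /counting; case: asboolP => _; rewrite ?lee_fin// leey. Qed.

Lemma lne_le_expR (x : \bar R) (r : R) : (0%:E <= x)%E ->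
  (lne x <= r%:E)%E = (x <= (expR r)%:E)%E.
Proof.
case: x => [x|_|]; last by rewrite leeNy_eq.
  2: by rewrite /= !leNgt !ltry.
rewrite lee_fin le_eqVlt => /orP[/eqP <-|x0]; first by rewrite /= lexx leNye lee_fin expR_ge0.
by rewrite lne_EFin// !lee_fin -ler_expR lnK.
Qed.

Lemma exp_growth_lt (T : choiceType) (B : nat -> set T) (a : R) :
  (exp_growth R B < a%:E)%E ->
  exists n0 : nat, forall n, (n0 <= n)%N -> cov (B n) (expR (a * n%:R)).
Proof.
move=> /ereal_inf_lt[_ [V [n0 _ Vn0] <-]] supV.
(* At [n = 0] the normalising factor [n^-1] is [0] and carries no information on [B 0]; [n0.+1]
   excludes this index. *)
exists n0.+1 => n n0n; apply/counting_cov; rewrite -lne_le_expR ?counting_ge0//.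
have nV : V n by apply: Vn0 => /=; exact: ltnW.
have n0' : 0 < n%:R :> R by rewrite ltr0n (leq_trans _ n0n).
have : ((n%:R^-1)%:E * lne (counting (B n)) <= a%:E)%E.
  by apply: le_trans (ltW supV); apply: ereal_sup_ubound; exists n.
by rewrite -lee_pdivlMl ?invr_gt0// invrK -EFinM mulrC.
Qed.

Lemma exp_growth_le (T : choiceType) (B : nat -> set T) (a : R) (n0 : nat) :
  (forall n, (n0 <= n)%N -> cov (B n) (expR (a * n%:R))) ->
  (exp_growth R B <= a%:E)%E.
Proof.
move=> covB; apply: ereal_inf_le; exists (ereal_sup ((fun n =>
   ((n%:R^-1)%:E * lne (counting (B n)))%E) @` [set n | (n0.+1 <= n)%N])).
  by exists [set n | (n0.+1 <= n)%N] => //; exists n0.+1.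
apply: ge_ereal_sup => _ [n /= n0n <-].
have n0' : 0 < n%:R :> R by rewrite ltr0n (leq_trans _ n0n).
rewrite -lee_pdivlMl ?invr_gt0// invrK -EFinM mulrC.
by rewrite lne_le_expR ?counting_ge0//; apply/counting_cov/covB/ltnW.
Qed.

Lemma exp_growth_ge0 (T : choiceType) (B : nat -> set T) :
  (forall n, B n !=set0) -> (0%:E <= exp_growth R B :> \bar R)%E.
Proof.
move=> B0; rewrite leNgt; apply/negP => /ereal_inf_lt[_ [V [n0 _ Vn0] <-]] supV.
have : ((n0.+1%:R^-1)%:E * lne (counting (B n0.+1)) < 0%:E :> \bar R)%E.
  apply: le_lt_trans supV; apply: ereal_sup_ubound; exists n0.+1 => //.
  by apply: Vn0 => /=.
apply/negP; rewrite -leNgt mule_ge0 ?lee_fin// lne_ge0.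
have [x Bx] := B0 n0.+1; rewrite /counting; case: asboolP => [finB|_]; last by rewrite leey.
rewrite lee_fin ler1n finmap.cardfs_gt0; apply/finmap.fset0Pn; exists x.
exact/(mem_fset_set x finB).
Qed.

Lemma mul_linear_expR_le (A b b' : R) : 0 <= A -> b < b' ->
  exists n0 : nat, forall n : nat, (n0 <= n)%N ->
    A * (n%:R + 2) * expR (b * n%:R) <= expR (b' * n%:R).
Proof.
move=> A0 bb'; pose c := (b' - b) / 2; have c0 : 0 < c by rewrite divr_gt0// subr_gt0.
exists (maxn 2 (Num.bound (2 * A / c ^+ 2))) => n; rewrite geq_max => /andP[n2 nA].
have -> : b' * n%:R = c * n%:R + (c * n%:R) + b * n%:R by rewrite /c; field.
rewrite !expRD ler_wpM2r ?expR_ge0//.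
have n2' : 2 <= n%:R :> R by rewrite (ler_nat _ 2).
have Ac : 2 * A <= c ^+ 2 * n%:R.
  rewrite -ler_pdivrMl ?exprn_gt0// mulrC; apply/ltW/(lt_le_trans (archi_boundP _)).
    by apply: divr_ge0; [exact: mulr_ge0 | exact: sqr_ge0].
  by rewrite ler_nat.
have cn : c * n%:R <= expR (c * n%:R) by have := expR_ge1Dx (c * n%:R); lra.
have cn0 : 0 <= c * n%:R by rewrite mulr_ge0// ltW.
apply: (@le_trans _ _ (c * n%:R * (c * n%:R))); last exact: ler_pM.
apply: (@le_trans _ _ (A * (2 * n%:R))); first by rewrite ler_wpM2l//; lra.
have -> : c * n%:R * (c * n%:R) = c ^+ 2 * n%:R * n%:R by ring.
by rewrite mulrA [A * 2]mulrC ler_wpM2r.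
Qed.
End Covers.

(** * Decomposition along a geodesic *)

Section RealTimes.
Variable R : realType.

Definition locally_closed_in (a b : R) (Q : R -> Prop) := forall t, a <= t <= b ->
  ~ Q t -> exists2 e, 0 < e & forall t', a <= t' <= b -> `|t - t'| < e -> ~ Q t'.

Lemma last_time (a b : R) (Q : R -> Prop) : a <= b -> locally_closed_in a b Q ->
  Q a -> exists s, [/\ a <= s <= b, Q s & forall t, s < t <= b -> ~ Q t].
Proof.
move=> ab closedQ Qa; pose S := [set t | a <= t <= b /\ Q t].
have supS : has_sup S.
  by split; [exists a; split; rewrite ?lexx | exists b => t [/andP[]]].
have Sle t : S t -> t <= sup S by apply: sup_upper_bound.
have aS : a <= sup S by apply: Sle; split; rewrite ?lexx.
have Sb : sup S <= b by apply: ge_sup; [exact: supS.1 | move=> t [/andP[]]].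
exists (sup S); rewrite aS Sb; split => // [|t /andP[st tb] Qt]; last first.
  by have := Sle t; rewrite leNgt st => /(_ _)/negP; apply; split => //; rewrite tb (le_trans aS (ltW st)).
apply: contrapT => nQ; have [|e e0 nQe] := closedQ _ _ nQ; first by rewrite aS.
have [t [tab Qt] st] := sup_adherent e0 supS; apply: (nQe t tab _ Qt).
have tS : 0 <= sup S - t by rewrite subr_ge0 Sle.
by rewrite (ger0_norm tS) ltrBlDr addrC -ltrBlDr.
Qed.

Lemma first_time (a b : R) (Q : R -> Prop) : a <= b -> locally_closed_in a b Q ->
  Q b -> exists s, [/\ a <= s <= b, Q s & forall t, a <= t < s -> ~ Q t].
Proof.
move=> ab closedQ Qb.
have [||| s [sab Qs sP]] := @last_time (- b) (- a) (Q \o -%R).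
- by rewrite lerN2.
- move=> t tab nQ; have [|e e0 nQe] := closedQ (- t) _ nQ; first lra.
  exists e => // t' t'ab tt'; apply: nQe; first lra.
  by rewrite opprK addrC distrC.
- by rewrite /= opprK.
exists (- s); split => //; first lra.
by move=> t tab; have := sP (- t); rewrite /= opprK; apply; lra.
Qed.
End RealTimes.

Section Decomposition.
Variables (R : realType) (G : groupType) (X : metricType R).
Variables (act : G -> X -> X) (o : X).
Hypothesis isoA : isometric_action act.
Hypothesis ball_finite : forall r, finite_set [set g | len act o g <= r].
Variables (M1 M2 sg : R).
Hypotheses (M1_gt0 : 0 < M1) (M12 : M1 <= M2) (sg0 : 0 < sg).
Local Notation ell := (len act o).
Local Notation O := (barrier_free act o M1 M2).

Definition at_orbit x := exists g, mdist x (act g o) <= M1.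

(** Only finitely many orbit points are near [x]. Hence the infimum in [neighborhood] can be
    replaced by an actual orbit point, and the visiting times of a geodesic form a closed set. *)
Lemma orbit_gap x : ~ at_orbit x ->
  exists2 e, 0 < e & forall g, M1 + e <= mdist x (act g o).
Proof.
move=> nx; have {}nx g : M1 < mdist x (act g o).
  by rewrite ltNge; apply/negP => gx; apply: nx; exists g.
have /finite_seqP[s sE] : finite_set [set g | mdist x (act g o) <= M1 + 1].
  have [[g0 g0x]|none] := EM (exists g, mdist x (act g o) <= M1 + 1); last first.
    by apply: (sub_finite_set _ (finite_set0 _)) => g gx; apply: none; exists g.
  apply: sub_finite_set (finite_image (fun g => (g0 * g)%g) (ball_finite (2 * M1 + 2))).
  move=> g /= gx; exists (g0^-1 * g)%g; last by rewrite mulVKg.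
  rewrite /= -mdist_orbit//; have := mdist_tri x (act g0 o) (act g o).
  by rewrite (metric_sym (act g0 o) x); lra.
have [e e0 [e1 eP]] : exists2 e, 0 < e & e <= 1 /\ forall g, g \in s -> M1 + e <= mdist x (act g o).
  elim: s {sE} => [|g s [e e0 [e1 eP]]]; first by exists 1.
  exists (Num.min e (mdist x (act g o) - M1)); first by rewrite lt_min e0 subr_gt0 nx.
  split=> [|k]; first by rewrite ge_min e1.
  rewrite inE => /orP[/eqP ->|/eP]; last by apply: le_trans; rewrite lerD2l ge_min lexx.
  by rewrite -lerBrDl ge_min lexx orbT.
exists e => // g; have [gx|] := leP (mdist x (act g o)) (M1 + 1).
  by apply: eP; suff : [set` s] g by []; rewrite -sE.
by move=> /ltW; apply: le_trans; rewrite lerD2l.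
Qed.

Lemma neighborhood_orbit x : neighborhood M1 (range (act^~ o)) x <-> at_orbit x.
Proof.
split=> [nx|[g gx]]; last first.
  apply: (@le_trans _ _ (mdist x (act g o))%:E); last by rewrite lee_fin.
  by apply: ereal_inf_lbound; exists (act g o); [exists g | rewrite edist_mdist].
apply: contrapT => /orbit_gap[e e0 eP].
suff : ((M1 + e)%:E <= M1%:E :> \bar R)%E by rewrite lee_fin gerDl leNgt e0.
apply: le_trans nx; apply: le_ereal_inf_tmp => _ [_ [g _ <-] <-].
by rewrite edist_mdist lee_fin.
Qed.

Lemma neighborhood1 (r : R) (x y : X) : mdist x y <= r -> neighborhood r [set y] x.
Proof.
move=> xy; apply: (@le_trans _ _ (mdist x y)%:E); last by rewrite lee_fin.
by apply: ereal_inf_lbound; exists y; rewrite ?edist_mdist.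
Qed.

Lemma at_orbit_act g x : at_orbit (act g x) <-> at_orbit x.
Proof.
split=> -[k kx]; first by exists (g^-1 * k)%g; rewrite actM// -(mdist_actl isoA).
by exists (g * k)%g; rewrite actM// mdist_act.
Qed.

(** The budget [l] is charged for the [m] factors in [S] alone; the connecting factors have length
    at most [D] and are free. *)
Fixpoint decomposition (S : set G) (D : R) (m : nat) (l : R) (g : G) : Prop :=
  if m is m'.+1 then exists s e g',
    [/\ ell s <= D, S e, g = (s * e * g')%g & decomposition S D m' (l - ell e) g']
  else ell g <= D /\ 0 <= l.

Lemma decomposition_le S D m l l' g : l <= l' ->
  decomposition S D m l g -> decomposition S D m l' g.
Proof.
elim: m l l' g => [|m IH] l l' g ll' /=.
  by move=> [gD l0]; split=> //; exact: le_trans ll'.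
move=> [s [e [g' [sD Se gE dec]]]]; exists s, e, g'; split=> //.
by apply: IH dec; rewrite lerD2r.
Qed.

Lemma decomposition_ge0 S D m l g : decomposition S D m l g -> 0 <= l.
Proof.
elim: m l g => [|m IH] l g /=; first by case.
by move=> [s [e [g' [_ _ _ /IH]]]]; rewrite subr_ge0; apply: le_trans; exact: len_ge0.
Qed.

Fixpoint spaced (gam : R -> X) (L t : R) (us : seq G) : Prop :=
  if us is u :: us' then exists t', [/\ t + sg <= t' <= L,
    mdist (gam t') (act u o) <= M1 & spaced gam L t' us'] else True.

(** From time [t], take the last orbit visit before [t + sg] and the first one after it: no visit
    lies between, so they bound a barrier-free factor. The later visits serve at the same time as
    insertion positions, so having few positions means having few factors. *)
Lemma greedy_decomposition L gam v : geodesic L gam ->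
  mdist (gam L) (act v o) <= M1 -> forall (n : nat) t x, 0 <= t <= L ->
  L - t <= n%:R * sg -> mdist (gam t) (act x o) <= M1 ->
  exists us, decomposition O (sg + 2 * M1) (size us)
      (L - t + 2 * M1 * (size us)%:R) (x^-1 * v)%g /\ spaced gam L t us.
Proof.
move=> [L0 isog] Lv.
have dgam t t' : 0 <= t <= L -> 0 <= t' <= L -> mdist (gam t) (gam t') = `|t - t'|.
  by move=> tL t'L; rewrite isog// in_itv.
have dorb t t' u u' : 0 <= t -> t <= t' -> t' <= L -> mdist (gam t) (act u o) <= M1 ->
    mdist (gam t') (act u' o) <= M1 -> ell (u^-1 * u')%g <= t' - t + 2 * M1.
  move=> t0 tt' t'L ut ut'; rewrite -mdist_orbit//.
  have := mdist_tri (gam t) (act u o) (act u' o).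
  have := mdist_tri (gam t') (gam t) (act u' o).
  rewrite dgam; [|lra|lra]; rewrite distrC ger0_norm ?subr_ge0//.
  by rewrite (metric_sym (act u o) (gam t)); lra.
have closedQ a b : 0 <= a -> b <= L -> locally_closed_in a b (at_orbit \o gam).
  move=> a0 bL t tab /= /orbit_gap[e e0 eP]; exists e => // t' t'ab tt' [g gt'].
  have := eP g; have := mdist_tri (gam t') (gam t) (act g o).
  by rewrite dgam; [lra|lra|lra].
have short t x : 0 <= t <= L -> L - t <= sg -> mdist (gam t) (act x o) <= M1 ->
  exists us, decomposition O (sg + 2 * M1) (size us)
      (L - t + 2 * M1 * (size us)%:R) (x^-1 * v)%g /\ spaced gam L t us.
  move=> /andP[t0 tL] tsg tx; exists [::]; split => //=; split; last by rewrite mulr0; lra.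
  by have := dorb t L x v t0 tL (lexx _) tx Lv; lra.
elim=> [|n IH] t x tL tn tx.
  by apply: short => //; rewrite mul0r in tn; exact: le_trans (ltW sg0).
have [|long] := leP (L - t) sg; first by move=> ?; exact: short.
have [|||s [sP [y ys] slast]] := @last_time _ t (t + sg) (at_orbit \o gam).
- by rewrite lerDl ltW.
- by apply: closedQ; have := sg0; lra.
- by exists x.
have [|||u [uP [z zu] ufirst]] := @first_time _ (t + sg) L (at_orbit \o gam).
- by lra.
- by apply: closedQ; have := sg0; lra.
- by exists v.
have [|||us [dec spa]] := IH u z; [have := sg0; lra | | exact: zu |].
  by move: tn; rewrite -natr1 mulrDl mul1r; lra.
exists (z :: us); split; last by exists u.
have su : s <= u by lra.
have s0 : 0 <= s by lra.
have eO : O (y^-1 * z)%g.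
  exists (u - s), (fun t' => act y^-1%g (gam (s + t'))); split.
  - split; first by rewrite subr_ge0.
    move=> t1 t2; rewrite !in_itv/= => t1P t2P.
    rewrite mdist_act// dgam; [|lra|lra].
    by congr (`|_|); ring.
  - apply: neighborhood1; rewrite addr0 -(mdist_act isoA y) actVK//.
    exact: le_trans M12.
  - apply: neighborhood1; rewrite addrC subrK actM// mdist_act//.
    exact: le_trans M12.
  - move=> t' t'P /neighborhood_orbit/at_orbit_act.
    have [ts|ts] := leP (s + t') (t + sg); first by apply: slast; lra.
    by apply: ufirst; lra.
have ell_e : ell (y^-1 * z)%g <= u - s + 2 * M1 by apply: dorb => //; lra.
exists (x^-1 * y)%g, (y^-1 * z)%g, (z^-1 * v)%g; split=> //.
- have : ell (x^-1 * y)%g <= s - t + 2 * M1 by apply: dorb => //; lra.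
  lra.
- by rewrite -!mulgA !mulVKg.
- apply: decomposition_le dec.
  have -> : (size (z :: us))%:R = (size us)%:R + 1 :> R by rewrite natr1.
  lra.
Qed.

Lemma spaced_subseq gam L t us us' : subseq us' us -> spaced gam L t us ->
  spaced gam L t us'.
Proof.
elim: us us' t => [|u us IH] [|u' us'] t //= sub [r [rP ru spa]].
case: ifP sub => [/eqP -> sub|_ sub]; first by exists r; split => //; exact: IH spa.
have [r' [r'P r'u spa']] := IH (u' :: us') r sub spa.
by exists r'; split => //; have := sg0; lra.
Qed.

Lemma spaced_uniq gam L t us : geodesic L gam -> 2 * M1 < sg -> 0 <= t ->
  spaced gam L t us -> uniq us.
Proof.
move=> [L0 isog] big; elim: us t => //= u us IH t t0 [r [rP ru spa]].
rewrite (IH r) ?andbT//; last by have := sg0; lra.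
apply/negP => uus; have : spaced gam L r [:: u].
  by apply: spaced_subseq spa; rewrite sub1seq.
move=> /= [r' [r'P r'u _]]; have := mdist_tri (act u o) (gam r') (gam r).
have rL : r \in `[0, L] by rewrite in_itv/=; have := sg0; lra.
have rL' : r' \in `[0, L] by rewrite in_itv/=; have := sg0; lra.
rewrite isog// (metric_sym (act u o) (gam r)); have := ler_norm (r' - r); lra.
Qed.

(** Going from [o] to [u], across to [z u'] and on to [z v] is at least as long as the geodesic, by
    minimality of [v]. The endpoints are [M1]-close to the geodesic, which costs [2 * M1] here and
    [2 * M1] in comparing [u^-1 * u'] with the time elapsed: hence [4 * M1]. *)
Lemma spaced_admissible (H : set G) D gam L us v t y : geodesic L gam -> gam 0 = o ->
  gam L = act v o -> (forall z, H z -> ell v <= ell (z * v)%g) ->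
  D + 2 * M1 < sg -> 0 <= t <= L -> mdist (gam t) (act y o) <= M1 ->
  spaced gam L t us ->
  admissible act o (4 * M1) D H y (rcons us v) /\
  path_length act o y (rcons us v) <= L - t + 2 * M1 * (size us).+1%:R.
Proof.
move=> [L0 isog] g0 gL vmin big.
have dgam s s' : 0 <= s -> s <= s' -> s' <= L -> mdist (gam s) (gam s') = s' - s.
  move=> s0 ss' s'L; rewrite isog ?in_itv/= ?s0 ?s'L ?andbT ?(le_trans ss')//.
    by rewrite distrC ger0_norm// subr_ge0.
  exact: le_trans ss'.
have vL : ell v = L by rewrite /len -gL -g0 dgam// subr0.
have M0 : 0 <= M1 := ltW M1_gt0.
have minimal s s' u u' : 0 <= s -> s <= s' -> s' <= L -> mdist (gam s) (act u o) <= M1 ->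
    mdist (gam s') (act u' o) <= M1 ->
    almost_minimal act o (4 * M1) H u u' /\ `|ell (u^-1 * u')%g - (s' - s)| <= 2 * M1.
  move=> s0 ss' s'L su su'; have dss := dgam _ _ s0 ss' s'L.
  have dist : `|ell (u^-1 * u')%g - (s' - s)| <= 2 * M1.
    rewrite -mdist_orbit// ler_distl -dss.
    have := mdist_tri (gam s) (act u o) (act u' o).
    have := mdist_tri (gam s') (gam s) (act u' o).
    have := mdist_tri (act u o) (gam s) (gam s').
    have := mdist_tri (act u' o) (act u o) (gam s').
    rewrite (metric_sym (act u o) (gam s)) (metric_sym (act u' o) (gam s')); lra.
  split=> // z Hz; move: dist; rewrite ler_distl => dist.
  have := vmin _ Hz; rewrite vL {1}/len actM//.
  have := mdist_tri (act u o) o (act z (act v o)).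
  have := mdist_tri (act z (act u' o)) (act u o) (act z (act v o)).
  have := mdist_tri (gam s) o (act u o); have := mdist_tri (gam s') (act u' o) (gam L).
  have d0 := dgam 0 s (lexx _) s0 (le_trans ss' s'L); rewrite g0 subr0 in d0.
  have dL := dgam s' L (le_trans s0 ss') s'L (lexx _).
  rewrite mdist_act// -gL d0 dL (metric_sym (act u' o) (gam s')).
  have -> : mdist (act u o) (act z (act u' o)) = ell (u^-1 * z * u')%g.
    by rewrite -actM// mdist_orbit// mulgA.
  by have := le_trans s0 ss'; lra.
elim: us t y => [|u us IH] t y tL ty /=.
  move=> _; have [|||||am dist] := minimal t L y v; [lra|lra|lra|done| |].
    by rewrite gL mdistxx.
  by split=> //; rewrite addr0 mulr1; move: dist; rewrite ler_distl; lra.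
move=> [r [rP ru spa]]; have sgp := sg0.
have [|||||am dist] := minimal t r y u; [lra|lra|lra|done|done|].
have rL : 0 <= r <= L by lra.
have [adm len_le] := IH r u rL ru spa.
move: dist; rewrite ler_distl => dist.
split; first by split=> // _; split=> //; lra.
by move: len_le; rewrite -[(size us).+2]addn1 natrD mulrDr mulr1; lra.
Qed.
End Decomposition.

(** * Poincare series and the number of decompositions *)

Section Counting.
Variables (R : realType) (G : groupType) (X : metricType R).
Variables (act : G -> X -> X) (o : X).
Hypothesis ball_finite : forall r, finite_set [set g | len act o g <= r].
Local Notation ell := (len act o).

Lemma cov_seq_union (I T : eqType) (s : seq I) (A : I -> set T) (r : I -> R) :
  (forall i, i \in s -> cov (A i) (r i)) ->
  cov [set x | exists2 i, i \in s & A i x] (\sum_(i <- s) r i).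
Proof.
elim: s => [|i s IH] covA.
  by rewrite big_nil; exists [::] => // x [].
rewrite big_cons; apply: (@cov_sub _ _ _ (A i `|` [set x | exists2 i, i \in s & A i x])) => //.
  by move=> x [k]; rewrite inE => /orP[/eqP ->|ks] Ax; [left | right; exists k].
by apply: cov_setU; [apply/covA/mem_head | apply: IH => k ks; apply: covA; rewrite inE ks orbT].
Qed.

Lemma finite_uniq_seq (T : choiceType) (A : set T) : finite_set A ->
  exists s : seq T, uniq s /\ A = [set` s].
Proof.
move=> /finite_seqP[s sE]; have [|t [ut At _]] := @cov_uniq R T A (size s)%:R.
  by exists s; rewrite // sE.
by exists t.
Qed.

Lemma ball_cov (Z : set G) (a : R) : 0 <= a -> (growth act o Z < a%:E)%E ->
  exists2 C0, 0 <= C0 & forall r, 0 <= r ->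
    cov ([set g | ell g <= r] `&` Z) (C0 * expR (a * r)).
Proof.
move=> a0 /exp_growth_lt[n0 covn]; exists (expR (a * (n0%:R + 1))); first exact: expR_ge0.
move=> r r0; have /andP[lo up] := truncn_itv r0.
apply: cov_sub (covn (n0 + (Num.truncn r).+1)%N (leq_addr _ _)).
  move=> g [gr Zg]; split=> //; rewrite /gball/= natrD.
  by have : 0 <= n0%:R :> R := ler0n _ _; move: gr; rewrite /= /len; lra.
rewrite -expRD ler_expR -mulrDr ler_wpM2l// natrD -natr1; lra.
Qed.

(** Summed over shells of width one, the series is dominated by a geometric one of ratio
    [expR (a - b)]. *)
Lemma poincare_sum (Z : set G) (a b C0 : R) : 0 <= b -> a < b -> 0 <= C0 ->
  (forall r, 0 <= r -> cov ([set g | ell g <= r] `&` Z) (C0 * expR (a * r))) ->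
  exists2 Th, 0 <= Th & forall es : seq G, uniq es -> (forall e, e \in es -> Z e) ->
    \sum_(e <- es) expR (- (b * ell e)) <= Th.
Proof.
move=> b0 ab C00 covZ; pose q := expR (a - b).
have q0 : 0 <= q := expR_ge0 _; have q1 : q < 1 by rewrite expR_lt1 subr_lt0.
have Ca0 : 0 <= C0 * expR a by rewrite mulr_ge0// expR_ge0.
exists (C0 * expR a / (1 - q)) => [|es ues esZ].
  by rewrite divr_ge0// subr_ge0 ltW.
have partial (n : nat) : \sum_(e <- es | ell e < n%:R) expR (- (b * ell e)) <=
    C0 * expR a * \sum_(k < n) q ^+ k.
  elim: n => [|n IH].
    rewrite big_ord0 mulr0 big1// => e; rewrite ltNge => /negP; elim; exact: mdist_ge0.
  rewrite big_ord_recr/= mulrDr (bigID (fun e => ell e < n%:R))/=; apply: lerD.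
    apply: le_trans IH; rewrite le_eqVlt; apply/orP; left; apply/eqP.
    apply: eq_bigl => e; rewrite andbC; case: ltP => //= en.
    by rewrite (lt_trans en)// ltr_nat.
  set P := (P in \sum_(e <- es | P e) _).
  have shell : (size [seq e <- es | P e])%:R <= C0 * expR (a * n.+1%:R).
    apply: cov_size (covZ _ (ler0n _ _)) _ _; first exact: filter_uniq.
    move=> e; rewrite mem_filter => /andP[/andP[en _] ees]; apply/asboolP.
    by split; [exact: ltW | exact: esZ].
  apply: (@le_trans _ _ (\sum_(e <- es | P e) expR (- (b * n%:R)))).
    apply: ler_sum => e /andP[_]; rewrite -leNgt => ne.
    by rewrite ler_expR lerN2 ler_wpM2l.
  rewrite -big_filter big_const_seq count_predT iter_addr_0.
  rewrite -[_ *+ _]mulr_natl; apply: (le_trans (ler_wpM2r (expR_ge0 _) shell)).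
  rewrite /q -expRM_natr -!mulrA ler_wpM2l// -!expRD ler_expR -natr1; lra.
have [n nP] : exists n : nat, forall e, e \in es -> ell e < n%:R.
  elim: (es) => [|e s [n nP]]; first by exists 0%N.
  exists (maxn n (Num.truncn (ell e)).+1) => k; rewrite inE => /orP[/eqP ->|/nP kn].
    have /andP[_ /lt_le_trans] := truncn_itv (mdist_ge0 o (act e o)); apply.
    by rewrite ler_nat leq_maxr.
  by apply: lt_le_trans kn _; rewrite ler_nat leq_maxl.
have -> : \sum_(e <- es) expR (- (b * ell e)) =
    \sum_(e <- es | ell e < n%:R) expR (- (b * ell e)).
  by rewrite big_seq [RHS]big_seq_cond; apply: eq_bigl => e; case: (boolP (e \in es)) => //= /nP ->.
apply: (le_trans (partial n)); rewrite ler_wpM2l//.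
rewrite -[X in _ <= X]mul1r ler_pdivlMr ?subr_gt0// mulrC.
have <- : 1 - q ^+ n = (1 - q) * \sum_(k < n) q ^+ k.
  by rewrite -[1 - q]opprB mulNr -subrX1 opprB.
by rewrite gerBl exprn_ge0.
Qed.

(** Peeling off a factor [e] leaves the budget [l - ell e], that is a weight [expR (- (b * ell e))];
    summing over [e] gives the Poincare series, hence a factor [Q * Th] per piece. *)
Lemma decomposition_cov (S : set G) (D b Th Q : R) : 0 <= b -> 0 <= Th ->
  cov [set g | ell g <= D] Q ->
  (forall es : seq G, uniq es -> (forall e, e \in es -> S e) ->
    \sum_(e <- es) expR (- (b * ell e)) <= Th) ->
  forall m l, cov [set g | decomposition act o S D m l g]
    (Q * (Q * Th) ^+ m * expR (b * l)).
Proof.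
move=> b0 Th0 covD Thsum; have [qs [uqs qsE qsQ]] := cov_uniq covD.
have Q0 : 0 <= Q := le_trans (ler0n _ _) qsQ.
elim=> [|m IH] l.
  have [l0|l0] := leP 0 l; last first.
    exists [::]; last by rewrite !mulr_ge0 ?expR_ge0.
    by move=> g [_]; rewrite leNgt l0.
  apply: cov_sub covD; first by move=> g [].
  by rewrite expr0 mulr1 ler_peMr// -expR0 ler_expR mulr_ge0.
have [es [ues esE]] : exists es : seq G, uniq es /\ [set g | ell g <= l] `&` S = [set` es].
  by apply: finite_uniq_seq; apply: sub_finite_set (ball_finite l) => g [].
apply: (@cov_sub _ _ _ [set g | exists2 s, s \in qs & exists2 e, e \in es &
    ((fun g' => s * e * g')%g @` [set g | decomposition act o S D m (l - ell e) g]) g]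
  (\sum_(s <- qs) \sum_(e <- es) Q * (Q * Th) ^+ m * expR (b * (l - ell e)))).
- move=> _ [s [e [g' [sD Se -> dec]]]].
  exists s; first by suff : [set` qs] s by []; rewrite -qsE.
  exists e; last by exists g'.
  suff : [set` es] e by []; rewrite -esE; split=> //=.
  by have := decomposition_ge0 dec; rewrite subr_ge0.
- rewrite big_const_seq count_predT iter_addr_0.
  under eq_bigr => e _ do rewrite mulrBr expRD.
  rewrite -mulr_sumr -mulr_sumr exprS.
  have := Thsum es ues; rewrite -[_ *+ _]mulr_natl => /(_ _) le_Th.
  have {}le_Th : \sum_(e <- es) expR (- (b * ell e)) <= Th.
    apply: le_Th => e ees; suff : ([set g | ell g <= l] `&` S) e by case.
    by rewrite esE.
  have -> : Q * (Q * Th * (Q * Th) ^+ m) * expR (b * l) =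
     Q * (Q * (Q * Th) ^+ m * (expR (b * l) * Th)) by ring.
  apply: ler_pM => //; rewrite ?mulr_ge0 ?exprn_ge0 ?mulr_ge0 ?expR_ge0 ?sumr_ge0//.
  rewrite ler_wpM2l ?mulr_ge0 ?exprn_ge0 ?mulr_ge0//.
  by rewrite ler_wpM2l// expR_ge0.
- apply: cov_seq_union => s _; apply: cov_seq_union => e _.
  exact: cov_image (IH _).
Qed.
End Counting.

(** * Counting minimal coset representatives *)

Section Subsequences.
Variables (T : eqType) (x0 : T).
Implicit Types (s : seq T).

Definition subseq_at s n (S : {set 'I_n}) : seq T :=
  [seq nth x0 s (i : 'I_n) | i <- enum S].

Lemma subseq_at_subseq s (S : {set 'I_(size s)}) : subseq (subseq_at s S) s.
Proof.
rewrite -[X in subseq _ X](mkseq_nth x0 s) /mkseq -val_enum_ord -map_comp.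
by rewrite /subseq_at {1}/enum_mem enumT; apply: map_subseq; exact: filter_subseq.
Qed.

Lemma size_subseq_at s n (S : {set 'I_n}) : size (subseq_at s S) = #|S|.
Proof. by rewrite size_map cardE. Qed.

Lemma subseq_at_inj s : uniq s -> injective (@subseq_at s (size s)).
Proof.
move=> us S S' eqS; apply/setP => i.
have inj : injective (fun i : 'I_(size s) => nth x0 s i).
  by move=> j k /eqP; rewrite nth_uniq ?ltn_ord// => /eqP/val_inj.
rewrite -[i \in S](mem_enum (mem S)) -[i \in S'](mem_enum (mem S')).
by rewrite -(mem_map inj) -[map _ _]/(subseq_at s S) eqS (mem_map inj).
Qed.
End Subsequences.

Section ManyPositions.
Variables (R : realType) (G : groupType) (ell : G -> R).
Variables (I : seq G -> G -> Prop) (Cm : nat) (C0 t rho Lam : R).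
Hypothesis cover : forall j w, exists ls : seq (seq G), (size ls <= Cm ^ j)%N /\
  forall l, size l = j.+1 -> I l w -> l \in ls.
Hypotheses (t0 : 0 <= t) (C00 : 0 <= C0) (rho0 : 0 <= rho) (Lam0 : 0 <= Lam).
Hypothesis ball_growth : forall r, 0 <= r -> cov [set g | ell g <= r] (C0 * expR (t * r)).
Variables (As : seq G) (m : nat) (us : G -> seq G).
Hypothesis uniqA : uniq As.
Hypothesis usP : forall v, v \in As -> [/\ size (us v) = m, uniq (us v) &
  forall us', subseq us' (us v) ->
    exists2 w, I (rcons us' v) w & ell w <= rho + Lam * (size us')%:R].

(** Double counting of the pairs of a [v] and a [j]-subset of its positions: distinct pairs give
    distinct paths, and at most [Cm ^ j] paths share a word in the ball. *)
Lemma insertions_count j : (size As)%:R * 'C(m, j)%:R <=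
  Cm%:R ^+ j * (C0 * expR (t * (rho + Lam * j%:R))).
Proof.
pose Ss := enum [set B : {set 'I_m} | #|B| == j]%SET.
pose Ls := [seq rcons (subseq_at 1%g (us v) B) v | v <- As, B <- Ss].
have sizeL : size Ls = (size As * 'C(m, j))%N.
  by rewrite size_allpairs -cardE card_draws card_ord.
have usE v : v \in As -> forall B : {set 'I_m},
    subseq (subseq_at 1%g (us v) B) (us v) /\
    forall B', subseq_at 1%g (us v) B = subseq_at 1%g (us v) B' -> B = B'.
  move=> /usP[sz uq _]; rewrite -sz => B; split; first exact: subseq_at_subseq.
  by move=> B' /(subseq_at_inj uq).
have uniqL : uniq Ls.
  apply: allpairs_uniq => //; first exact: enum_uniq.
  move=> [v B] [v' B'] /allpairsP[[v1 B1] [vA _ [-> ->]]] /allpairsP[[v2 B2] [_ _ [-> ->]]] /=.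
  by move=> /rcons_inj[+ vv']; rewrite -vv' => /((usE _ vA _).2) ->.
have r0 : 0 <= rho + Lam * j%:R by rewrite addr_ge0// mulr_ge0.
have [bs bsP bsS] := ball_growth r0.
have /choice[LS LSP] w := cover j w.
have sub : {subset Ls <= flatten [seq LS w | w <- bs]}.
  move=> l /allpairsP[[v B] /= [vA]]; rewrite mem_enum inE => /eqP Sj -> {l}.
  have [_ _ /(_ _ (usE _ vA B).1)[w Iw ww]] := usP vA.
  apply/flattenP; exists (LS w).
    by apply: map_f; apply: bsP => /=; move: ww; rewrite size_subseq_at Sj.
  by apply: (LSP w).2 => //; rewrite size_rcons size_subseq_at Sj.
rewrite -natrM -sizeL.
apply: (@le_trans _ _ (size bs * Cm ^ j)%:R).
  rewrite ler_nat (leq_trans (uniq_leq_size uniqL sub))//.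
  rewrite -(size_map LS bs); apply: size_flatten_le.
  by apply/allP => _ /mapP[w _ ->]; case: (LSP w).
by rewrite natrM mulrC natrX ler_wpM2l// exprn_ge0.
Qed.

(* Each insertion multiplies the count by the number of positions, at the bounded
   cost [1 / kap] per insertion. *)
Lemma many_positions_count (kap : R) : 0 <= kap ->
  kap * Cm%:R * expR (t * Lam) <= 1 ->
  (size As)%:R * (1 + kap) ^+ m <= (m%:R + 1) * (C0 * expR (t * rho)).
Proof.
move=> kap0 small; rewrite exprDn mulr_sumr.
have bound (j : 'I_m.+1) : true -> (size As)%:R * (1 ^+ (m - j) * kap ^+ j *+ 'C(m, j)) <=
    C0 * expR (t * rho).
  move=> _; have -> : (size As)%:R * (1 ^+ (m - j) * kap ^+ j *+ 'C(m, j)) =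
      (size As)%:R * 'C(m, j)%:R * kap ^+ j.
    by rewrite expr1n mul1r -(mulr_natl (kap ^+ j)) mulrA.
  apply: (le_trans (ler_wpM2r (exprn_ge0 _ kap0) (insertions_count j))).
  have -> : Cm%:R ^+ j * (C0 * expR (t * (rho + Lam * j%:R))) * kap ^+ j =
      (kap * Cm%:R * expR (t * Lam)) ^+ j * (C0 * expR (t * rho)).
    have -> : t * (rho + Lam * j%:R) = t * rho + t * Lam * j%:R by ring.
    by rewrite expRD expRM_natr !exprMn; ring.
  rewrite ler_piMl ?mulr_ge0 ?expR_ge0// exprn_ile1//.
  by rewrite !mulr_ge0 ?expR_ge0.
apply: (le_trans (ler_sum _ bound)).
by rewrite sumr_const card_ord -(mulr_natl (C0 * _)) natr1.
Qed.
End ManyPositions.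

Section Arithmetic.
Variable R : realType.

Lemma natr_divn (n p : nat) : (0 < p)%N -> n%:R / p%:R <= (n %/ p).+1%:R :> R.
Proof.
move=> p0; rewrite ler_pdivrMr ?ltr0n// -natrM ler_nat; apply: ltnW; exact: ltn_ceil.
Qed.

Lemma expn_divn_le (K c : R) : 1 <= K -> 0 < c -> exists2 p : nat, (0 < p)%N &
  forall n : nat, K ^+ (n %/ p).+1 <= K * expR (c * n%:R).
Proof.
move=> K1 c0; have K0 : 0 < K := lt_le_trans ltr01 K1.
have lnK0 : 0 <= ln K by exact: ln_ge0.
have [p p0 pK] : exists2 p, (0 < p)%N & (Num.bound (ln K / c) <= p)%N.
  by exists (Num.bound (ln K / c)).+1.
exists p => // n; have {}p0 : 0 < p%:R :> R by rewrite ltr0n.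
have Kp : ln K / p%:R <= c.
  rewrite ler_pdivrMr// mulrC -ler_pdivrMr//.
  apply/ltW/(lt_le_trans (archi_boundP _)); first by rewrite divr_ge0// ltW.
  by rewrite ler_nat.
have np : (n %/ p)%:R <= n%:R / p%:R :> R.
  rewrite ler_pdivlMr// -natrM ler_nat; exact: leq_trunc_div.
rewrite exprS; apply: ler_wpM2l; first exact: ltW.
rewrite -{1}(lnK (K0 : K \in Num.pos)) -expRM_natr ler_expR.
apply: (@le_trans _ _ (ln K * (n%:R / p%:R))); first exact: ler_wpM2l.
have -> : ln K * (n%:R / p%:R) = ln K / p%:R * n%:R by ring.
exact: ler_wpM2r.
Qed.

(** The gain rate [ln (1 + kap) / p], written [2 * e], does not involve [t]. With [t] at most
    [w + e], half of the gain pays for the excess of [t] over [w] and the rest gives the rate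
    [w - e]. The bound [t <= w + 1] lets [kap] be fixed beforehand. *)
Lemma many_positions_rate (w Lam kap : R) (p : nat) :
    0 <= w -> 0 <= Lam -> 0 < kap -> (0 < p)%N ->
  exists t b : R, [/\ w < t, t <= w + 1, b < w &
    forall (C N : R) (n : nat), 0 <= C -> 0 <= N ->
      N * (1 + kap) ^+ (n %/ p).+1 <=
        ((n %/ p).+1%:R + 1) * (C * expR (t * (n%:R + Lam))) ->
      N <= C * expR (t * Lam) * (n%:R + 2) * expR (b * n%:R)].
Proof.
move=> w0 Lam0 kap0 p0; have p0' : 0 < p%:R :> R by rewrite ltr0n.
have kp : 1 + kap \in Num.pos by rewrite posrE addr_gt0.
have [q qE] : exists q, q = ln (1 + kap) by exists (ln (1 + kap)).
have q0 : 0 < q by rewrite qE ln_gt0// ltrDl.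
have [e eE] : exists e, e = q / (2 * p%:R) by exists (q / (2 * p%:R)).
have e0 : 0 < e by rewrite eE divr_gt0// mulr_gt0.
have qe : q / p%:R = 2 * e by rewrite eE; field; rewrite gt_eqF.
have [eta [eta0 eta1 etae]] : exists eta : R, [/\ 0 < eta, eta <= 1 & eta <= e].
  exists (Num.min 1 e); split; last 2 first.
  - by rewrite ge_min lexx.
  - by rewrite ge_min lexx orbT.
  - by rewrite lt_min ltr01.
exists (w + eta), (w - e); split; [lra | lra | lra | move=> C N n C0 N0 le].
have qm : expR (q * (n%:R / p%:R)) <= (1 + kap) ^+ (n %/ p).+1.
  rewrite -{1}(lnK kp) -expRM_natr ler_expR -qE; apply: ler_wpM2l; first exact: ltW.
  exact: natr_divn.
have mn : (n %/ p).+1%:R + 1 <= n%:R + 2 :> R.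
  have : (n %/ p)%:R <= n%:R :> R by rewrite ler_nat leq_div.
  by rewrite -natr1; lra.
have CE0 r : 0 <= C * expR r by apply: mulr_ge0; [exact: C0 | exact: expR_ge0].
have step : N * expR (q * (n%:R / p%:R)) <= (n%:R + 2) * (C * expR ((w + eta) * (n%:R + Lam))).
  apply: le_trans (le_trans le _); first exact: ler_wpM2l.
  exact: ler_wpM2r.
have n0 : 0 <= n%:R :> R := ler0n _ _.
apply: (@le_trans _ _ (C * expR ((w + eta) * Lam) * (n%:R + 2) * expR ((w + eta - 2 * e) * n%:R))).
  rewrite -(ler_pM2r (expR_gt0 (q * (n%:R / p%:R)))); apply: (le_trans step).
  rewrite -[leRHS]mulrA -expRD.
  have -> : (w + eta - 2 * e) * n%:R + q * (n%:R / p%:R) = (w + eta) * n%:R.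
    by rewrite mulrCA [q / _]mulrC mulrC in qe *; rewrite -qe; ring.
  have -> : (w + eta) * (n%:R + Lam) = (w + eta) * Lam + (w + eta) * n%:R by ring.
  by rewrite expRD le_eqVlt; apply/orP; left; apply/eqP; ring.
apply: ler_wpM2l; first by apply: mulr_ge0 => //; lra.
rewrite ler_expR; apply: ler_wpM2r => //; lra.
Qed.
End Arithmetic.

Section CosetGrowth.
Variables (R : realType) (G : groupType) (X : metricType R).
Variables (act : G -> X -> X) (o : X).
Hypothesis isoA : isometric_action act.
Local Notation ell := (len act o).

Lemma seq_argmin (T : eqType) (f : T -> R) (s : seq T) x0 : x0 \in s ->
  exists2 x, x \in s & forall y, y \in s -> f x <= f y.
Proof.
elim: s x0 => [//|y s IH] x0 _; case: s IH => [_|z s IH].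
  by exists y; rewrite ?mem_head// => x; rewrite inE => /eqP ->.
have [x xs xmin] := IH z (mem_head _ _).
have [xy|/ltW yx] := leP (f x) (f y).
  by exists x; [rewrite inE xs orbT | move=> w; rewrite inE => /orP[/eqP ->|/xmin]].
exists y; first exact: mem_head.
by move=> w; rewrite inE => /orP[/eqP ->|/xmin] //; exact: le_trans.
Qed.

Lemma proper_ball_finite : proper_space X -> proper_action act ->
  forall r, finite_set [set g | ell g <= r].
Proof.
move=> prX prA r; apply: sub_finite_set (prA _ (prX o r)) => g /= gr.
exists (act g o); split=> //=; exists o => //=.
by rewrite mdistxx (le_trans _ gr)// mdist_ge0.
Qed.

Hypothesis ball_finite : forall r, finite_set [set g | ell g <= r].

Lemma ball_argmin (A : set G) (x : X) : A !=set0 ->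
  exists2 g, A g & forall k, A k -> mdist x (act g o) <= mdist x (act k o).
Proof.
move=> [g0 Ag0].
have /finite_seqP[s sE] : finite_set (A `&` [set g | mdist x (act g o) <= mdist x (act g0 o)]).
  apply: sub_finite_set (ball_finite (mdist x o + mdist x (act g0 o))) => g [_ /= gx].
  by have := mdist_tri x o (act g o); rewrite (metric_sym o x) /len; lra.
have mem_s g : g \in s <-> A g /\ mdist x (act g o) <= mdist x (act g0 o).
  by have -> : (g \in s : Prop) = [set` s] g by []; rewrite -sE.
have [g /mem_s[Ag gg0] gmin] := seq_argmin (fun g => mdist x (act g o)) ((mem_s g0).2 (conj Ag0 (lexx _))).
exists g => // k Ak; have [kk|/ltW kk] := leP (mdist x (act k o)) (mdist x (act g0 o)).
  by apply: gmin; apply/mem_s.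
exact: le_trans kk.
Qed.

Lemma axis_has_proj h x :
  exists p, is_proj (range (fun n : int => act (expgz h n) o)) x p.
Proof.
have [|g [n _ <-] gmin] := @ball_argmin (range (expgz h)) x; first by exists 1%g, 0.
exists (act (expgz h n) o); split; first by exists n.
by move=> _ [k _ <-]; apply: gmin; exists k.
Qed.

Definition minimal_in (H : set G) (v : G) := forall z, H z -> ell v <= ell (z * v)%g.

(** Inversion passes from the left cosets counted by [coset_growth] to the cosets [H v], on which
    [H] acts by left multiplication. *)
Lemma coset_ball_minimal (H : subgroup_space G) n :
  coset_ball act o H n `<=` (fun v => left_coset v^-1%g H) @`
    [set v | ell v <= n%:R /\ minimal_in (carrier H) v].
Proof.
have [H1 HB] : group_closed (fun x : G => set_val H x) := set_valP H.
move=> _ [g gn <-].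
have [|x [k Hk gkx] xmin] := @ball_argmin (left_coset g H) o.
  by exists (g * 1)%g, 1%g => //; exact: carrier1.
have xH y : left_coset x H y <-> left_coset g H y.
  rewrite -gkx; split=> -[k' Hk' <-].
    exists (k * k')%g; last by rewrite mulgA.
    exact: (group_closedM (conj H1 HB) Hk Hk').
  exists (k^-1 * k')%g; last by rewrite -mulgA mulVKg.
  exact: (group_closedM (conj H1 HB) (carrierV Hk) Hk').
exists x^-1%g; last by apply/seteqP; split=> y; rewrite invgK; apply xH.
split.
  rewrite (lenV o isoA) -lee_fin; apply: le_trans gn.
  apply: le_ereal_inf_tmp => _ [_ [y gy <-] <-].
  by rewrite edist_mdist lee_fin xmin.
move=> z Hz; rewrite (lenV o isoA) -[leRHS](lenV o isoA) invgM invgK; apply: xmin.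
by apply/xH; exists z^-1%g => //; exact: carrierV.
Qed.

(** Each piece multiplies the count by at most [K]; with about one piece per [p] units of length and
    [p] large, this spends only half of the gap between [b] and [w]. *)
Lemma few_pieces_cov (S : set G) (r b w M Q Th : R) :
    0 <= b -> b < w -> 0 <= Q -> 0 <= Th ->
    (forall k l, cov [set v | decomposition act o S r k l v]
       (Q * (Q * Th) ^+ k * expR (b * l))) ->
  exists2 p : nat, (0 < p)%N & exists2 A, 0 <= A & forall n : nat,
    cov [set v | exists2 k, k \in iota 0 (n %/ p).+1 &
                  decomposition act o S r k (n%:R + M * k%:R) v]
        (A * (n%:R + 2) * expR ((b + w) / 2 * n%:R)).
Proof.
move=> b0 bw Q0 Th0 covdec; have c0 : 0 < (w - b) / 2 by rewrite divr_gt0// subr_gt0.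
pose K' := Q * Th * expR (b * M); pose K := Num.max 1 K'.
have K1 : 1 <= K by rewrite le_max lexx.
have KK' : K' <= K by rewrite le_max lexx orbT.
have K'0 : 0 <= K' by rewrite !mulr_ge0 ?expR_ge0.
have K0 : 0 <= K := le_trans ler01 K1.
have [p p0 expn_le] := expn_divn_le K1 c0.
exists p => //; exists (Q * K) => [|n]; first exact: mulr_ge0.
have n0 : 0 <= n%:R :> R := ler0n _ _.
have e0 r' : 0 <= expR r' :> R := expR_ge0 _.
have mn : (n %/ p).+1%:R <= n%:R + 2 :> R.
  have : (n %/ p)%:R <= n%:R :> R by rewrite ler_nat leq_div.
  by rewrite -natr1; lra.
have covfew := cov_seq_union (s := iota 0 (n %/ p).+1)
  (fun k _ => covdec k (n%:R + M * k%:R)).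
apply: cov_sub covfew; first exact: subset_refl.
apply: (@le_trans _ _ (\sum_(k <- iota 0 (n %/ p).+1) Q * K * expR ((b + w) / 2 * n%:R))).
  rewrite big_seq [leRHS]big_seq; apply: ler_sum => k.
  rewrite mem_iota add0n => /andP[_ km].
  have -> : b * (n%:R + M * k%:R) = b * n%:R + b * M * k%:R by ring.
  rewrite expRD (expRM_natr k (b * M)).
  have -> : Q * (Q * Th) ^+ k * (expR (b * n%:R) * expR (b * M) ^+ k) =
      Q * (K' ^+ k * expR (b * n%:R)) by rewrite /K' [(Q * Th * expR _) ^+ k]exprMn; ring.
  rewrite -mulrA; apply: ler_wpM2l => //.
  have Kk : K' ^+ k <= K * expR ((w - b) / 2 * n%:R).
    apply: le_trans (expn_le n); apply: (@le_trans _ _ (K ^+ k)).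
      by apply: lerXn2r.
    by apply: ler_weXn2l => //; exact: ltnW.
  apply: (le_trans (ler_wpM2r (e0 _) Kk)).
  have -> : (b + w) / 2 * n%:R = (w - b) / 2 * n%:R + b * n%:R by field.
  by rewrite expRD mulrA.
rewrite big_const_seq count_predT iter_addr_0 size_iota -[_ *+ _]mulr_natr.
rewrite [leRHS]mulrAC; apply: ler_wpM2l => //; apply: mulr_ge0 => //; exact: mulr_ge0.
Qed.

End CosetGrowth.

Section MinimalGrowth.
Variables (R : realType) (G : groupType) (X : metricType R).
Variables (act : G -> X -> X) (o : X).
Hypothesis isoA : isometric_action act.
Local Notation ell := (len act o).
Hypothesis ball_finite : forall r, finite_set [set g | ell g <= r].
Hypothesis geodX : geodesic_space X.
Variables (M1 M2 : R).
Hypotheses (M1_gt0 : 0 < M1) (M12 : M1 <= M2).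
Local Notation O := (barrier_free act o M1 M2).

Lemma minimal_positions (H : set G) (D sg l : R) (m : nat) (v : G) :
    0 < sg -> D + 2 * M1 < sg -> 2 * M1 < sg -> minimal_in act o H v -> ell v <= l ->
    (forall k, (k < m)%N -> ~ decomposition act o O (sg + 2 * M1) k (l + 2 * M1 * k%:R) v) ->
  exists us, [/\ size us = m, uniq us & forall us', subseq us' us ->
    admissible act o (4 * M1) D H 1%g (rcons us' v) /\
    path_length act o 1%g (rcons us' v) <= l + 2 * M1 * (size us').+1%:R].
Proof.
move=> sg0 Dsg Msg vmin vl nfew.
have [L [gam [geo g0 gL]]] := geodX o (act v o).
have [L0 isog] := geo.
have vL : ell v = L.
  rewrite /len -gL -{1}g0 isog ?in_itv/= ?lexx ?L0//.
  by rewrite sub0r normrN ger0_norm.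
have at0 : mdist (gam 0) (act 1%g o) <= M1 by rewrite g0 act1// mdistxx ltW.
have in0L : (0 : R) <= 0 <= L by rewrite lexx L0.
have atL : mdist (gam L) (act v o) <= M1 by rewrite gL mdistxx ltW.
have boundL : L - 0 <= (Num.bound (L / sg))%:R * sg.
  by rewrite subr0 -ler_pdivrMr//; apply/ltW/archi_boundP; rewrite divr_ge0// ltW.
have [us [dec spa]] := greedy_decomposition isoA ball_finite M12 sg0 geo atL in0L boundL at0.
rewrite subr0 invg1 mul1g -vL in dec.
have m_us : (m <= size us)%N.
  rewrite leqNgt; apply/negP => us_m; apply: (nfew _ us_m).
  by apply: decomposition_le dec; rewrite lerD2r.
(* Truncation gives every [v] the same number [m] of positions, as the binomial count requires. *)
have spa' := spaced_subseq sg0 (take_subseq us m) spa.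
exists (take m us); split.
- exact: size_takel.
- exact: (spaced_uniq sg0 geo Msg (lexx (0 : R)) spa').
move=> us' sub; have spa'' := spaced_subseq sg0 sub spa'.
have [adm len_le] := spaced_admissible isoA M1_gt0 sg0 geo g0 gL vmin Dsg in0L at0 spa''.
split=> //; apply: (le_trans len_le); rewrite subr0 -vL; lra.
Qed.

Variables (w a : R).
Hypothesis (a0 : 0 <= a) (aw : a < w).
Hypothesis (growthG : growth act o setT = w%:E) (growthO : (growth act o O < a%:E)%E).
Variables (D Fm : R) (Cm : nat) (ins : set G -> G -> seq G -> G -> Prop).
Hypothesis Fm0 : 0 <= Fm.

Definition insertable (H : set G) :=
  (forall l y, admissible act o (4 * M1) D H y l -> exists w, ins H y l w /\
     ell w <= path_length act o y l + Fm * (size l)%:R) /\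
  (forall j y w, exists ls : seq (seq G), (size ls <= Cm ^ j)%N /\
     forall l, size l = j.+1 -> ins H y l w -> l \in ls).

Lemma minimal_growth : exists2 b, b < w & exists2 A, 0 <= A &
  forall (H : set G) (n : nat), insertable H ->
    cov [set v | ell v <= n%:R /\ minimal_in act o H v]
        (A * (n%:R + 2) * expR (b * n%:R)).
Proof.
have a_w := aw; have M10 := M1_gt0; have w0 : 0 <= w := le_trans a0 (ltW aw).
have [b [ab bw]] : exists b, a < b /\ b < w by exists ((a + w) / 2); lra.
have b0 : 0 <= b := le_trans a0 (ltW ab).
have [C0 C00 covO] := ball_cov a0 growthO.
have [Th Th0 ThP] := poincare_sum b0 ab C00 covO.
have [sg [sg0 Dsg Msg]] : exists sg, [/\ 0 < sg, D + 2 * M1 < sg & 2 * M1 < sg].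
  by exists (`|D| + 2 * M1 + 1); have := normr_ge0 D; have := ler_norm D; split; lra.
have [Q [Q0 covQ]] : exists Q : R, 0 <= Q /\ cov [set g | ell g <= sg + 2 * M1] Q.
  have /finite_seqP[qs qsE] := ball_finite (sg + 2 * M1).
  by exists (size qs)%:R; split=> //; exists qs; rewrite // qsE.
have [p p0 [A1 A10 fewP]] := few_pieces_cov (2 * M1) b0 bw Q0 Th0
  (decomposition_cov ball_finite b0 Th0 covQ ThP).
have [Lam [LamE Lam0]] : exists Lam, Lam = 2 * M1 + Fm /\ 0 <= Lam.
  by exists (2 * M1 + Fm); split=> //; rewrite addr_ge0// mulr_ge0// ltW.
have Cm1 : 0 < Cm%:R + 1 :> R by rewrite ltr_wpDl.
have [kap [kap0 kapE]] : exists kap, 0 < kap /\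
    forall t, t <= w + 1 -> kap * Cm%:R * expR (t * Lam) <= 1.
  exists ((Cm%:R + 1) * expR ((w + 1) * Lam))^-1; split=> [|t tw].
    by rewrite invr_gt0 mulr_gt0// expR_gt0.
  rewrite -mulrA mulrC ler_pdivrMr ?mulr_gt0 ?expR_gt0// mul1r.
  apply: ler_pM; [exact: ler0n | exact: expR_ge0 | by rewrite lerDl |].
  by rewrite ler_expR; exact: ler_wpM2r.
have [t [b2 [wt tw b2w rate]]] := many_positions_rate w0 Lam0 kap0 p0.
have t0 : 0 <= t := le_trans w0 (ltW wt).
have growt : (growth act o setT < t%:E)%E by rewrite growthG lte_fin.
have [C1 C10 covT] := ball_cov t0 growt.
have {}covT r : 0 <= r -> cov [set g | ell g <= r] (C1 * expR (t * r)).
  by move=> /covT; apply: cov_sub; [move=> g gr; split | exact: lexx].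
have A20 : 0 <= C1 * expR (t * Lam) by apply: mulr_ge0 => //; exact: expR_ge0.
have [bb [bbw b1bb b2bb]] : exists bb, [/\ bb < w, (b + w) / 2 <= bb & b2 <= bb].
  exists (Num.max ((b + w) / 2) b2); rewrite gt_max !le_max !lexx orbT; split=> //.
  by apply/andP; split => //; lra.
exists bb => //; exists (A1 + C1 * expR (t * Lam)) => [|H n [insE insC]].
  exact: addr_ge0.
have n2 : 0 <= n%:R + 2 :> R by rewrite addr_ge0.
have exp_le A (r : R) : 0 <= A -> r <= bb ->
    A * (n%:R + 2) * expR (r * n%:R) <= A * (n%:R + 2) * expR (bb * n%:R).
  move=> A_ge0 rbb; apply: ler_wpM2l; first exact: mulr_ge0.
  by rewrite ler_expR; exact: ler_wpM2r.
have {}fewP := fewP n; set few := (X in cov X _) in fewP.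
have [As [uAs AsE]] : exists s : seq G, uniq s /\
  [set v | ell v <= n%:R /\ minimal_in act o H v] `&` ~` few = [set` s].
  by apply: (@finite_uniq_seq R); apply: sub_finite_set (ball_finite n%:R) => v [[]].
(* A path with [j] insertion points has [j + 1] pieces, each costing at most [2 * M1 + Fm = Lam];
   the separate [Lam] is that of the last piece. *)
have /choice[us usP] v : exists us : seq G, v \in As ->
  [/\ size us = (n %/ p).+1, uniq us & forall us', subseq us' us ->
  exists2 w, ins H 1%g (rcons us' v) w & ell w <= n%:R + Lam + Lam * (size us')%:R].
  have [vA|] := boolP (v \in As); last by exists [::].
  have [[vn vmin] nfew] : ([set v | ell v <= n%:R /\ minimal_in act o H v] `&` ~` few) v.
    by rewrite AsE.
  have [|us [usm usu usP]] := minimal_positions (m := (n %/ p).+1) sg0 Dsg Msg vmin vn.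
    by move=> k km dec; apply: nfew; exists k; rewrite // mem_iota.
  exists us => _; split=> // us' /usP[adm len_le].
  have [w' [insw w'le]] := insE _ _ adm; exists w' => //.
  move: w'le; rewrite size_rcons; move: len_le; rewrite -natr1 LamE; lra.
have many := many_positions_count (fun j w => insC j 1%g w) C10
  (addr_ge0 (ler0n _ n) Lam0) Lam0 covT uAs usP (ltW kap0) (kapE t tw).
have As_le := le_trans (rate _ _ _ C10 (ler0n _ _) many) (exp_le _ _ A20 b2bb).
have {}fewP := cov_sub (@subset_refl _ few) (exp_le _ _ A10 b1bb) fewP.
have covAs : cov [set` As] (C1 * expR (t * Lam) * (n%:R + 2) * expR (bb * n%:R)).
  by exists As; first exact: subset_refl.
rewrite !mulrDl; apply: cov_sub (cov_setU fewP covAs); last exact: lexx.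
by move=> v mv; have [|nf] := EM (few v); [left | right; rewrite -AsE].
Qed.
End MinimalGrowth.

Theorem corollary1p5 (R : realType) (G : groupType) (X : metricType R)
    (act : G -> X -> X) (o : X) (U : set (subgroup_space G)) :
  non_elementary G ->
  proper_space X ->
  geodesic_space X ->
  isometric_action act ->
  proper_action act ->
  SCC act o ->
  (exists h : G, contracting_element act o h) ->
  maximal_finite_normal (triv_subgroup G) ->
  uniformly_recurrent U ->
  U <> [set triv_subgroup G] ->
  exists omega0 : R, (omega0%:E < growth act o setT)%E /\
    forall H : subgroup_space G, U H -> (coset_growth act o H <= omega0%:E)%E.
Proof.
move=> nonel prX geodX isoA prA [M1 [M2 [M1_gt0 M12 growth_lt growth_fin]]].
move=> [h [[lam [c [lam1 c0 qgeo]]] [C cset]]] maxN urU nontriv.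
have ball_finite := proper_ball_finite o prX prA.
have cZ := contracting_set_contr (axis_has_proj ball_finite h) cset.
(* The identity is barrier-free through a constant geodesic, whose interior is empty. This rules out
   the value [-oo], so both growth rates are real numbers. *)
have growth_ge0 : (0%:E <= growth act o (barrier_free act o M1 M2))%E.
  apply: exp_growth_ge0 => n; exists 1%g; split.
    by rewrite /gball/= (act1 isoA) mdistxx.
  have M2_ge0 : 0 <= M2 := le_trans (ltW M1_gt0) M12.
  exists 0, (fun=> o); split.
  - split=> // s t; rewrite !in_itv/= => /le_anti <- /le_anti <-.
    by rewrite mdistxx subrr normr0.
  - by apply: neighborhood1; rewrite mdistxx.
  - by apply: neighborhood1; rewrite (act1 isoA) mdistxx.
  - by move=> t /andP[t0 /(lt_trans t0)]; rewrite ltxx.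
have [w growthG] : exists w, growth act o setT = w%:E.
  exists (fine (growth act o setT)); rewrite fineK// ge0_fin_numE//.
  exact: le_trans growth_ge0 (ltW growth_lt).
have [r growthO] : exists r, growth act o (barrier_free act o M1 M2) = r%:E.
  exists (fine (growth act o (barrier_free act o M1 M2))); rewrite fineK// ge0_fin_numE//.
  exact: lt_trans growth_fin.
have r0 : 0 <= r by rewrite -lee_fin -growthO.
have rw : r < w by rewrite -lte_fin -growthO -growthG.
have [a [a0 ra aw]] : exists a, [/\ 0 <= a, r < a & a < w].
  by exists ((r + w) / 2); split; lra.
have Oa : (growth act o (barrier_free act o M1 M2) < a%:E)%E by rewrite growthO lte_fin.
have [P P1 PU] := confining_set urU nontriv.
have eps0 : 0 <= 4 * M1 by rewrite mulr_ge0// ltW.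
have [D [Fm [Cm [ins [Fm0 insP]]]]] :=
  insertion geodX isoA ball_finite lam1 c0 qgeo cZ nonel maxN P1 eps0.
have [b bw [A A0 few_minimal]] :=
  minimal_growth isoA ball_finite geodX M1_gt0 M12 a0 aw growthG Oa D Cm ins Fm0.
(* The midpoint absorbs the factor [A * (n + 2)]; [b] and [A] were fixed before [H]. *)
exists ((b + w) / 2); split; first by rewrite growthG lte_fin; lra.
move=> H UH; have [n0 n0P] : exists n0 : nat, forall n : nat, (n0 <= n)%N ->
    A * (n%:R + 2) * expR (b * n%:R) <= expR ((b + w) / 2 * n%:R).
  by apply: mul_linear_expR_le; lra.
apply: (exp_growth_le (n0 := n0)) => n n0n.
have insH : insertable act o M1 D Fm Cm ins (carrier H).
  by apply: insP => [g|g]; [exact: carrierV | exact: PU].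
apply: cov_sub (cov_image _ (few_minimal _ n insH)); last exact: n0P.
exact: coset_ball_minimal.
Qed.
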